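(* Let $n$ be a positive integer and $\epsilon \in (0,1)$. There exists a subset $S \subseteq [n]\times[n]$ of $s = O(n/\epsilon^2)$ entries such that, letting $\mathbf S \in \mathbb{R}^{n\times n}$ have $\mathbf S_{ij} = \frac{n^2}{s}$ for $(i,j)\in S$ and $\mathbf S_{ij}=0$ otherwise, simultaneously for all positive semidefinite matrices $\mathbf A \in \mathbb{R}^{n\times n}$ with bounded entries, $$\|\mathbf A - \mathbf A \circ \mathbf S\|_2 \le \epsilon n.$$
   Context: A matrix $\mathbf A$ has bounded entries if $\max_{i,j}|\mathbf A_{ij}| \le 1$. $\circ$ denotes the entrywise (Hadamard) product and $\|\cdot\|_2$ the spectral (operator) norm. $[n]=\{1,\dots,n\}$. *)

(* Defs.v *)
From HB Require Import structures.
From mathcomp Require Import all_boot all_order all_algebra.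
From mathcomp Require Import boolp classical_sets reals.

Set Implicit Arguments.
Unset Strict Implicit.
Unset Printing Implicit Defensive.

Import Order.TTheory GRing.Theory Num.Theory.
Local Open Scope classical_set_scope.
Local Open Scope ring_scope.

Definition l2norm (R : realType) (n : nat) (x : 'cV[R]_n) : R :=
  Num.sqrt (\sum_(i < n) x i 0 ^+ 2).

(* Operator norm induced by the Euclidean norm. The set is nonempty and bounded
   above (by the Frobenius norm of M), so [sup] is its least upper bound. *)
Definition spectral_norm (R : realType) (m n : nat) (M : 'M[R]_(m, n)) : R :=
  sup [set l2norm (M *m x) | x in [set x : 'cV[R]_n | l2norm x <= 1]].

(* Real positive semidefinite matrices are required to be symmetric. *)
Definition psd (R : realType) (n : nat) (A : 'M[R]_n) : Prop :=
  A^T = A /\ forall x : 'cV[R]_n, 0 <= (x^T *m A *m x) 0 0.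

Definition bounded_entries (R : realType) (m n : nat) (A : 'M[R]_(m, n)) : Prop :=
  forall i j, `|A i j| <= 1.

Definition hadamard (R : realType) (m n : nat) (A B : 'M[R]_(m, n)) : 'M[R]_(m, n) :=
  map2_mx *%R A B.

Definition sampling_mx (R : realType) (n : nat) (S : {set 'I_n * 'I_n}) : 'M[R]_n :=
  \matrix_(i, j) if (i, j) \in S then n%:R ^+ 2 / #|S|%:R else 0.

(* Main.v *)
(* Include every entry of an n x n matrix independently with probability p, put
   q = sqrt (p n), a constant over eps, and discard the rows and columns holding
   more than 12 q^2 chosen entries. With positive probability the surviving
   matrix S' satisfies |x^T (J - S'/p) y| <= K (n/q) |x| |y| for all x and y, J
   being the all-ones matrix (an argument of Kahn-Szemeredi and Feige-Ofek).
   After scaling, a bilinear form is largest on vectors whose entries are 0 or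
   signed powers of 2 with squared norm at most 5n, and only exp(O(n)) of these
   exist. For a pair (z, w) of them:
   - the light pairs, |z_i w_j| <= q, are controlled by an exponential moment and
     a union bound over all (z, w);
   - the heavy pairs contribute O(q n) to the mean by themselves. Their
     contribution to S' is summed over the level sets of z and w, using the
     degree bound if |z_i| and |w_j| differ by a factor q or more, and otherwise
     a bound on the number of chosen entries in each rectangle I x J, obtained by
     a union bound over subsets.
   Normalising by n^2/#S' instead of 1/p costs another O(n/q). Finally A is a sum
   of matrices v v^T, so the form of A o W at (x, y) is the sum of the forms of W
   at (x o v, y o v); unit diagonal bounds then give |A o W| <= |W|. *)
Require Import Defs.
From mathcomp Require Import all_boot all_order all_algebra.
From mathcomp Require Import reals.
From mathcomp Require Import zify ring lra.
From mathcomp Require Import sequences exp.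

Set Implicit Arguments.
Unset Strict Implicit.
Unset Printing Implicit Defensive.

Import Order.TTheory GRing.Theory Num.Theory.
Local Open Scope ring_scope.

(** * Elementary inequalities for exp and ln *)

Section ExpBounds.
Variable R : realType.
Implicit Types c : R.

(** From exp(-c/2) >= 1 - c/2 follows (1 - c/2)^2 exp c <= 1, while (1 - c/2)^2 (1 + c + 2c^2)
    exceeds 1 by c^2 (5 - 2c)(1 - c) / 4, which is nonnegative here. *)
Lemma expR_le_quadratic c : c <= 1 -> expR c <= 1 + c + 2 * c ^+ 2.
Proof.
move=> c1.
have h0 : 0 < 1 - c / 2 by lra.
have h1 : 1 - c / 2 <= expR (- (c / 2)) by apply: expR_ge1Dx.
have h2 : (1 - c / 2) ^+ 2 * expR c <= 1.
  have e1 : expR (- (c / 2)) ^+ 2 * expR c = 1.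
    by rewrite expr2 -!expRD (_ : _ + _ = 0) ?expR0 //; lra.
  by rewrite -[leRHS]e1 ler_pM2r ?expR_gt0// lerXn2r// ?nnegrE ?expR_ge0// ltW.
have h3 : 1 <= (1 - c / 2) ^+ 2 * (1 + c + 2 * c ^+ 2).
  have : 0 <= c ^+ 2 * ((5 - 2 * c) * (1 - c)).
    by rewrite mulr_ge0 ?sqr_ge0// mulr_ge0//; lra.
  nra.
by rewrite -(ler_pM2l (exprn_gt0 2 h0)); apply: le_trans h3.
Qed.

Lemma expR1_le4 : expR 1 <= 4 :> R.
Proof. by apply: (le_trans (@expR_le_quadratic 1 _)) => //; lra. Qed.

Lemma expR1_ge2 : 2 <= expR 1 :> R.
Proof. by have := @expR_ge1Dx R 1; lra. Qed.

Lemma ln_le_pred c : 0 < c -> ln c <= c - 1.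
Proof. by move=> c0; have := expR_ge1Dx (ln c); rewrite lnK ?posrE//; lra. Qed.

End ExpBounds.

(** * Independent sampling and exponential moments *)

Section Bernoulli.
Variables (R : realType) (T : finType) (p : R).
Hypotheses (p0 : 0 <= p) (p1 : p <= 1).
Implicit Types (f : {ffun T -> bool}) (F : {ffun T -> bool} -> R).

(** The product measure is given by explicit weights on a finite outcome space, so that expectations
    are finite sums. *)
Definition bernoulli_mass f : R := \prod_e (if f e then p else 1 - p).
Definition expect F : R := \sum_f bernoulli_mass f * F f.

Lemma bernoulli_mass_ge0 f : 0 <= bernoulli_mass f.
Proof. by apply: prodr_ge0 => e _; case: ifP => _; rewrite ?subr_ge0. Qed.

(** Independence: distributing the product over the two values of each coordinate yields the
    weighted sum over all outcomes. *)
Lemma expect_prod (g : T -> bool -> R) :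
  expect (fun f => \prod_e g e (f e)) =
  \prod_e (p * g e true + (1 - p) * g e false).
Proof.
have -> : \prod_e (p * g e true + (1 - p) * g e false) =
    \prod_e \sum_b (if b then p else 1 - p) * g e b.
  by apply: eq_bigr => e _; rewrite big_bool.
by rewrite bigA_distr_bigA; apply: eq_bigr => f _; rewrite /= -big_split.
Qed.

Lemma expect1 : expect (fun=> 1) = 1.
Proof.
transitivity (expect (fun _ => \prod_(e : T) 1)).
  by apply: eq_bigr => f _; rewrite big1_eq.
by rewrite (expect_prod (fun _ _ => 1)) big1// => e _; rewrite !mulr1 addrC subrK.
Qed.

Lemma expect_sum (I : finType) (P : pred I) (F : I -> {ffun T -> bool} -> R) :
  expect (fun f => \sum_(i | P i) F i f) = \sum_(i | P i) expect (F i).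
Proof. by rewrite exchange_big; apply: eq_bigr => f _; rewrite mulr_sumr. Qed.

Lemma expectD F G : expect (fun f => F f + G f) = expect F + expect G.
Proof. by rewrite -big_split; apply: eq_bigr => f _; rewrite mulrDr. Qed.

Lemma expectZ a F : expect (fun f => a * F f) = a * expect F.
Proof. by rewrite mulr_sumr; apply: eq_bigr => f _; rewrite mulrCA. Qed.

(** First moment method: the masses are nonnegative and add up to 1, so [F >= 1] everywhere would
    make the mean at least 1. *)
Lemma expect_lt1_exists F : expect F < 1 -> exists f, F f < 1.
Proof.
move=> F1; apply/existsP; move: F1; apply: contraLR.
rewrite negb_exists -leNgt => /forallP F1.
rewrite -expect1; apply: ler_sum => f _.
by rewrite ler_wpM2l ?bernoulli_mass_ge0// leNgt.
Qed.

(** By independence the mean factorises, and each factor 1 + p (e^c - 1) is at most exp(p (e^c -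
    1)). *)
Lemma expect_expR (c : T -> R) :
  expect (fun f => expR (\sum_e c e * (f e)%:R))
    <= expR (p * \sum_e (expR (c e) - 1)).
Proof.
have -> : expect (fun f => expR (\sum_e c e * (f e)%:R)) =
    expect (fun f => \prod_e expR (c e * (f e)%:R)).
  by apply: eq_bigr => f _; rewrite expR_sum.
rewrite (expect_prod (fun e b => expR (c e * b%:R))) mulr_sumr expR_sum.
apply: ler_prod => e _; rewrite mulr1 mulr0 expR0 mulr1.
rewrite addr_ge0 ?mulr_ge0 ?expR_ge0 ?subr_ge0//=.
by apply: le_trans (expR_ge1Dx _); lra.
Qed.

(** Centring removes the linear part of e^c - 1, and [expR_le_quadratic] bounds the rest by 2c^2. *)
Lemma expect_expR_centered (c : T -> R) : (forall e, c e <= 1) ->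
  expect (fun f => expR (\sum_e c e * ((f e)%:R - p)))
    <= expR (2 * p * \sum_e c e ^+ 2).
Proof.
move=> c1.
have -> : expect (fun f => expR (\sum_e c e * ((f e)%:R - p))) =
    expR (- (p * \sum_e c e)) * expect (fun f => expR (\sum_e c e * (f e)%:R)).
  rewrite -expectZ; apply: eq_bigr => f _; congr (_ * _).
  rewrite -expRD mulr_sumr -sumrN -big_split; congr (expR _).
  by apply: eq_bigr => e _ /=; ring.
apply: (le_trans (ler_wpM2l (expR_ge0 _) (expect_expR c))).
rewrite -expRD ler_expR !mulr_sumr -sumrN -big_split; apply: ler_sum => e _ /=.
by have := ler_wpM2l p0 (expR_le_quadratic (c1 e)); lra.
Qed.

End Bernoulli.

(** * Dyadic levels and the entropy of level sets *)

Section Levels.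
Variable R : realType.
Implicit Types (k L n : nat) (t q A : R).

(** The values 0, 1, 2, 4, ...: index 0 is kept for a vanishing entry. *)
Definition lev k : R := if k is k'.+1 then 2 ^+ k' else 0.

Lemma lev_ge0 k : 0 <= lev k.
Proof. by case: k => //= k; rewrite exprn_ge0. Qed.

Lemma lev_ge1 k : (0 < k)%N -> 1 <= lev k.
Proof. by case: k => //= k _; rewrite exprn_ege1// ler1n. Qed.

Lemma lev_gt0 k : (0 < k)%N -> 0 < lev k.
Proof. by move=> /lev_ge1; apply: lt_le_trans. Qed.

Lemma sum_lev L : \sum_(k < L.+1) lev k + 1 = 2 ^+ L.
Proof.
elim: L => [|L IH]; first by rewrite big_ord1 add0r.
by rewrite big_ord_recr/= addrAC IH exprS; ring.
Qed.

Lemma sum_lev_lt L t : 0 <= t -> \sum_(k < L | lev k < t) lev k <= 2 * t.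
Proof.
move=> t0; elim: L => [|L IH]; first by rewrite big_ord0 mulr_ge0.
rewrite big_mkcond big_ord_recr/= -big_mkcond/=.
case: ifPn => [Lt|_]; last by rewrite addr0.
apply: (@le_trans _ _ (\sum_(k < L.+1) lev k)).
  rewrite big_ord_recr/= lerD2r big_mkcond; apply: ler_sum => i _.
  by case: ifP => // _; apply: lev_ge0.
move: (sum_lev L) Lt; case: L {IH} => [|L] /=; first by rewrite expr0; lra.
by rewrite exprS; lra.
Qed.

Lemma sum_inv_lev L : \sum_(k < L) (lev k)^-1 <= 2.
Proof.
case: L => [|L]; first by rewrite big_ord0.
suff -> : \sum_(k < L.+1) (lev k)^-1 = 2 - 2 / 2 ^+ L.
  by rewrite lerBlDr lerDl divr_ge0// exprn_ge0.
(* The term at level 0 vanishes, as the inverse of 0 is 0. *)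
elim: L => [|L IH]; first by rewrite big_ord1 /= invr0 expr0 divr1 subrr.
rewrite big_ord_recr/= IH exprS.
have : (2 : R) ^+ L != 0 by rewrite expf_neq0 ?pnatr_eq0.
by move=> h; field.
Qed.

(* [exp (ent n k)] bounds 'C(n, k); the junk value of [n / 0] is killed by the factor k. *)
Definition ent n k : R := k%:R * (1 + ln (n%:R / k%:R)).

Lemma ent0 n : ent n 0 = 0. Proof. by rewrite /ent mul0r. Qed.

Lemma ent_ge n k : (k <= n)%N -> k%:R <= ent n k.
Proof.
case: k => [_|k kn]; first by rewrite ent0.
rewrite ler_peMr// lerDl ln_ge0// ler_pdivlMr ?ltr0n// mul1r ler_nat.
exact: kn.
Qed.

Lemma ent_ge0 n k : (k <= n)%N -> 0 <= ent n k.
Proof. by move=> /ent_ge; apply: le_trans. Qed.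

Lemma ent_le n k : (k <= n)%N -> ent n k <= n%:R.
Proof.
case: k => [|k kn]; first by rewrite ent0.
have k0 : 0 < k.+1%:R :> R by rewrite ltr0n.
have n0 : 0 < n%:R :> R by rewrite ltr0n (leq_trans _ kn).
have := ln_le_pred (divr_gt0 n0 k0).
rewrite -(ler_pM2l k0) mulrBr mulr1 mulrCA mulfV ?gt_eqF// mulr1 /ent.
by lra.
Qed.

(** As ln(n/k) >= 0, dropping its factor k leaves k + ln n - ln k, and k - 1 >= ln k. *)
Lemma ent_ge_ln n k : (0 < k <= n)%N -> 1 + ln n%:R <= ent n k.
Proof.
case/andP=> k0 kn.
have k0' : 0 < k%:R :> R by rewrite ltr0n.
have k1 : 1 <= k%:R :> R by rewrite ler1n.
have n0 : 0 < n%:R :> R by rewrite ltr0n (leq_trans k0).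
have lnge : 0 <= ln (n%:R / k%:R : R).
  by rewrite ln_ge0// ler_pdivlMr// mul1r ler_nat.
have := ln_le_pred k0'; move: lnge; rewrite /ent ln_div ?posrE//.
by nra.
Qed.

(** Write n/k as A^3 times n/(A^3 k) and use ln y <= y - 1 on the second factor. For a level set of
    value A, the remainder n/A^3 stays summable after the weight A^2. *)
Lemma ent_le_level n k A : (0 < n)%N -> 1 <= A ->
  ent n k <= k%:R * (1 + 3 * ln A) + n%:R / A ^+ 3.
Proof.
move=> n0 A1; have A0 : 0 < A by apply: lt_le_trans A1.
have nA : 0 < n%:R / A ^+ 3 by rewrite divr_gt0 ?ltr0n// exprn_gt0.
case: k => [|k]; first by rewrite ent0 mul0r add0r ltW.
have k0 : 0 < k.+1%:R :> R by rewrite ltr0n.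
rewrite /ent; move: (k.+1%:R : R) k0 => K k0.
have -> : n%:R / K = A ^+ 3 * (n%:R / A ^+ 3 / K).
  by field; rewrite (gt_eqF A0) (gt_eqF k0).
have y0 : 0 < n%:R / A ^+ 3 / K by rewrite divr_gt0.
rewrite lnM ?posrE ?exprn_gt0// lnXn//.
have := ln_le_pred y0; rewrite -(ler_pM2l k0) mulrBr mulr1 mulrCA mulfV ?gt_eqF//.
by rewrite mulr1 !mulrDr mulr1 mulr_natl; lra.
Qed.

(** For fixed a, the levels below [lev a * q] sum to at most twice that bound, so the inner sum is
    O(q) times (lev a)^2 k + n / lev a. The first part sums to O(n) by the norm bound, the second by
    the geometric series. *)
Lemma sum_level_entropy L n (kk : 'I_L -> nat) q (theta : 'I_L -> 'I_L -> R) :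
    (0 < n)%N -> 1 <= q -> (forall a, (kk a <= n)%N) ->
    \sum_(a < L) lev a ^+ 2 * (kk a)%:R <= 5 * n%:R ->
    (forall a b, 1 <= theta a b) ->
    (forall a b : 'I_L, (0 < a)%N -> q <= lev b -> 1 + ln (lev a) <= theta a b) ->
  \sum_(a < L | (0 < a)%N) \sum_(b < L | lev b < lev a * q)
    lev a * lev b * (ent n (kk a) / theta a b) <= 68 * q * n%:R.
Proof.
move=> n0 q1 kkn kk2 th1 thA.
have q0 : 0 < q by apply: lt_le_trans q1.
have nge0 : 0 <= n%:R :> R by [].
pose Y (a : 'I_L) := 3 * (lev a ^+ 2 * (kk a)%:R) + n%:R * (lev a)^-1.
apply: (@le_trans _ _ (\sum_(a < L) 4 * q * Y a)); last first.
  rewrite -mulr_sumr big_split/= -!mulr_sumr.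
  have sumV := ler_wpM2l nge0 (sum_inv_lev L).
  (* 17 = 3 * 5 + 2, from the norm bound 5n and from [sum_inv_lev]. *)
  have -> : 68 * q * n%:R = 4 * q * (17 * n%:R) by ring.
  rewrite ler_pM2l ?mulr_gt0//; lra.
rewrite [leLHS]big_mkcond; apply: ler_sum => a _.
have Yge0 : 0 <= Y a.
  by rewrite addr_ge0// mulr_ge0// ?invr_ge0 ?lev_ge0// mulr_ge0// exprn_ge0 ?lev_ge0.
case: ifPn => [a0|_]; last by rewrite !mulr_ge0// ltW.
have A1 := lev_ge1 a0; have A0 := lev_gt0 a0.
have lnA0 : 0 <= ln (lev a) by apply: ln_ge0.
have entL := ent_le_level (kk a) n0 A1.
have ent0 := ent_ge0 (kkn a).
move: (ent n (kk a)) ent0 entL => E ent0 entL.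
set A := lev a in A1 A0 lnA0 entL *; set k : R := (kk a)%:R in entL.
have k0 : 0 <= k by rewrite /k.
set W := n%:R / A ^+ 3 in entL.
have W0 : 0 <= W by rewrite divr_ge0// exprn_ge0// ltW.
have kA0 : 0 <= k * A by rewrite mulr_ge0// ltW.
have C1 : 0 <= A * (3 * k + W) by apply: mulr_ge0; [exact: ltW|lra].
have Y_E : Y a = 3 * (A ^+ 2 * k) + A ^+ 2 * W.
  by rewrite /Y -/A -/k /W; field; rewrite gt_eqF.
(* Below q the logarithm in ent is not absorbed by theta, but lev b < q leaves a factor
   1 / A to spare. *)
rewrite (bigID (fun b : 'I_L => q <= lev b))/=.
have -> : 4 * q * Y a = A * (3 * k + W) * (2 * (A * q)) + 2 * q * Y a.
  by rewrite Y_E; ring.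
apply: lerD.
  apply: (@le_trans _ _ (\sum_(b < L | lev b < A * q) A * (3 * k + W) * lev b)).
    rewrite big_mkcondr/=; apply: ler_sum => b bA.
    have l0 := lev_ge0 b.
    case: ifPn => qb; last by rewrite mulr_ge0.
    rewrite -!mulrA ler_pM2l// [leLHS]mulrC ler_wpM2r//.
    rewrite ler_pdivrMr; last by apply: lt_le_trans (th1 a b).
    apply: (le_trans entL).
    apply: (@le_trans _ _ ((3 * k + W) * (1 + ln A))); first by nra.
    by apply: ler_wpM2l; [lra|apply: thA].
  rewrite -mulr_sumr ler_wpM2l//.
  by apply: sum_lev_lt; rewrite mulr_ge0 ?ltW.
apply: (@le_trans _ _ (\sum_(b < L | lev b < q) A * (3 * k * A + W) * lev b)).
  under eq_bigl do rewrite -ltNge andbC.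
  rewrite big_mkcondr/=; apply: ler_sum => b bA.
  have l0 := lev_ge0 b.
  have C0 : 0 <= 3 * k * A + W by lra.
  case: ifPn => qb; last by rewrite !mulr_ge0 // ltW.
  rewrite -!mulrA ler_pM2l// [leLHS]mulrC mulrA ler_wpM2r//.
  rewrite ler_pdivrMr; last by apply: lt_le_trans (th1 a b).
  apply: (@le_trans _ _ (3 * k * A + W)); last by rewrite ler_peMr.
  apply: (le_trans entL); rewrite lerD2r.
  by have := ln_le_pred A0; nra.
rewrite -mulr_sumr.
have C0 : 0 <= A * (3 * k * A + W).
  by apply: mulr_ge0; [exact: ltW|lra].
apply: le_trans (ler_wpM2l C0 (sum_lev_lt L (ltW q0))) _.
rewrite Y_E.
have AW : A * W <= A ^+ 2 * W by rewrite ler_wpM2r// expr2 ler_peMl// ltW.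
by have := ler_wpM2l (ltW q0) AW; lra.
Qed.

End Levels.

(** * Counting subsets by entropy *)

Section SubsetEntropy.
Variables (R : realType) (n : nat).
Hypothesis n0 : (0 < n)%N.

Let n0R : 0 < n%:R :> R. Proof. by rewrite ltr0n. Qed.

(** One term of the binomial expansion of (1 + k/n)^n is at most the whole, which is at most e^k. *)
Lemma binomial_le_expR_ent k : (k <= n)%N -> 'C(n, k)%:R <= expR (ent R n k).
Proof.
case: k => [|k] kn; first by rewrite ent0 expR0 bin0.
have k0 : 0 < k.+1%:R :> R by rewrite ltr0n.
have r0 : 0 < k.+1%:R / n%:R :> R by rewrite divr_gt0.
have nk0 : 0 < n%:R / k.+1%:R :> R by rewrite divr_gt0.
rewrite /ent mulrDr mulr1 expRD expRM_natl lnK ?posrE//.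
rewrite -ler_pdivrMr ?exprn_gt0// -exprVn invf_div.
apply: (@le_trans _ _ ((1 + k.+1%:R / n%:R) ^+ n)).
  rewrite exprDn (bigD1 (inord k.+1))//= inordK ?ltnS// expr1n mul1r.
  rewrite -[X in _ <= X + _]mulr_natl lerDl sumr_ge0// => i _.
  by rewrite mulrn_wge0// expr1n mul1r exprn_ge0// ltW.
apply: (@le_trans _ _ (expR (k.+1%:R / n%:R) ^+ n)).
  by rewrite lerXn2r ?nnegrE ?expR_ge0 ?expR_ge1Dx// addr_ge0// ltW.
by rewrite -expRM_natl mulrC divfK// gt_eqF.
Qed.

Lemma sum_inv_binomial :
  \sum_(I : {set 'I_n}) ('C(n, #|I|)%:R)^-1 = n.+1%:R :> R.
Proof.
rewrite (partition_big (fun I : {set 'I_n} => inord #|I| : 'I_n.+1) predT)//=.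
rewrite -[RHS]mul1r mulr_natr -[in RHS](card_ord n.+1) -sumr_const.
apply: eq_bigr => k _.
rewrite (eq_bigl (fun I => I \in [set I : {set 'I_n} | #|I| == k])); last first.
  move=> I; rewrite inE -val_eqE/= inordK// ltnS.
  by rewrite -[X in (_ <= X)%N](card_ord n) max_card.
rewrite (eq_bigr (fun=> ('C(n, k)%:R)^-1)); last by move=> I; rewrite inE => /eqP ->.
rewrite sumr_const card_draws card_ord -[LHS]mulr_natr mulVf//.
by rewrite pnatr_eq0 -lt0n bin_gt0 -ltnS.
Qed.

(** One factor exp(-ent) cancels the number of subsets of each size, leaving n + 1 sizes; the other
    three are at most 1/(2n) each, since ent >= 1 + ln n on nonempty sets and e >= 2. *)
Lemma sum_expR_ent :
  \sum_(I : {set 'I_n} | I != set0) expR (- (4 * ent R n #|I|)) <= (4 * n%:R ^+ 2)^-1.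
Proof.
have e1 : expR (- (1 + ln n%:R)) <= (2 * n%:R)^-1 :> R.
  rewrite expRN expRD lnK ?posrE// lef_pV2 ?posrE ?mulr_gt0 ?expR_gt0//.
  by rewrite ler_pM2r// expR1_ge2.
apply: (@le_trans _ _ (\sum_(I : {set 'I_n})
    ('C(n, #|I|)%:R)^-1 * ((2 * n%:R)^-1) ^+ 3)).
  rewrite big_mkcond; apply: ler_sum => I _.
  have In : (#|I| <= n)%N by rewrite -[X in (_ <= X)%N](card_ord n) max_card.
  have c0 : 0 < ('C(n, #|I|))%:R :> R by rewrite ltr0n bin_gt0.
  have i2 : 0 < (2 * n%:R)^-1 :> R by rewrite invr_gt0 mulr_gt0.
  case: ifPn => I0; last by rewrite mulr_ge0 ?invr_ge0 ?exprn_ge0// ltW.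
  have -> : - (4 * ent R n #|I|) = - ent R n #|I| + 3%:R * (- ent R n #|I|) by ring.
  rewrite expRD expRM_natl; apply: ler_pM; rewrite ?expR_ge0 ?exprn_ge0 ?expR_ge0//.
    by rewrite expRN lef_pV2 ?posrE ?expR_gt0// binomial_le_expR_ent.
  rewrite lerXn2r ?nnegrE ?expR_ge0// ?(ltW i2)//.
  apply: le_trans e1; rewrite ler_expR lerN2 ent_ge_ln//.
  by rewrite card_gt0 I0.
rewrite -mulr_suml sum_inv_binomial.
have -> : ((2 * n%:R)^-1) ^+ 3 = (2 * n%:R)^-1 * (4 * n%:R ^+ 2)^-1 :> R.
  by field; rewrite gt_eqF.
rewrite mulrA ler_piMl ?invr_ge0 ?mulr_ge0 ?exprn_ge0//.
rewrite ler_pdivrMr ?mulr_gt0// mul1r -natrM ler_nat; lia.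
Qed.

End SubsetEntropy.

(** * The random sample: union bounds for light pairs and for rectangles *)

Section RandomSample.
Variables (R : realType) (n L : nat) (p q : R).
Hypotheses (n0 : (0 < n)%N) (p0 : 0 <= p) (p1 : p <= 1) (q1 : 1 <= q).
Hypothesis pnq : p * n%:R = q ^+ 2.
Implicit Types (f : {ffun 'I_n * 'I_n -> bool}) (I J : {set 'I_n}).

Definition count_in f I J : R := \sum_(e | (e.1 \in I) && (e.2 \in J)) (f e)%:R.

Definition signed_lev (v : 'I_L * bool) : R := (-1) ^+ v.2 * lev R v.1.

(** The constant 5 is the cost of rounding a vector of squared norm at most n, whose entries x
    become levels of square at most 1 + 4x^2. *)
Definition lev_vec (z : {ffun 'I_n -> 'I_L * bool}) : bool :=
  \sum_i signed_lev (z i) ^+ 2 <= 5 * n%:R.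

Definition light_sum f (z w : {ffun 'I_n -> 'I_L * bool}) : R :=
  \sum_(e | `|signed_lev (z e.1) * signed_lev (w e.2)| <= q)
     signed_lev (z e.1) * signed_lev (w e.2) * ((f e)%:R - p).

(** The shift is set so that a cost below 1 forces every light sum to be at most 68qn. *)
Definition light_cost f : R :=
  \sum_(zw | lev_vec zw.1 && lev_vec zw.2)
    expR (q^-1 * light_sum f zw.1 zw.2 - 68 * n%:R).

(* The exponential parameter [1 + ln t] is taken on the grid t = lev j, so that a union
   bound over the grid lets t depend on the rectangle. *)
Definition discrepancy_exponent f I J (j : 'I_L) : R :=
  (1 + ln (lev R j)) * count_in f I J
  - (4 * (p * #|I|%:R * #|J|%:R * lev R j)
     + 4 * ent R n #|I| + 4 * ent R n #|J|).

(** Empty sets are left out because they have entropy 0: with both sides empty the term would be exp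
    0 = 1. *)
Definition discrepancy_cost f : R :=
  \sum_(j < L | (0 < j)%N) \sum_(I | I != set0) \sum_(J | J != set0)
    expR (discrepancy_exponent f I J j).

Let n0R : 0 < n%:R :> R. Proof. by rewrite ltr0n. Qed.
Let q0 : 0 < q. Proof. exact: lt_le_trans q1. Qed.

Lemma sqr_signed_lev v : signed_lev v ^+ 2 = lev R v.1 ^+ 2.
Proof. by rewrite /signed_lev exprMn -signr_odd sqrr_sign mul1r. Qed.

(** Each z counted has weight exp(5n - |z|^2) >= 1, and the sum of the weights factorises over
    coordinates. Each coordinate factor is at most 2(1 + 2) <= 8 <= e^3, the 2 accounting for
    signs. *)
Lemma card_lev_vec : \sum_(z | lev_vec z) 1 <= expR (8 * n%:R) :> R.
Proof.
apply: (@le_trans _ _ (\sum_(z : {ffun 'I_n -> 'I_L * bool}) expR (5 * n%:R) *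
    \prod_i expR (- signed_lev (z i) ^+ 2))).
  rewrite big_mkcond; apply: ler_sum => z _.
  case: ifPn => [zT|_]; last first.
    by rewrite mulr_ge0 ?expR_ge0// prodr_ge0// => i _; rewrite expR_ge0.
  by rewrite -expR_sum sumrN -expRD -[leLHS](@expR0 R) ler_expR subr_ge0.
rewrite -mulr_sumr -(bigA_distr_bigA (fun _ v => expR (- signed_lev v ^+ 2)))/=.
rewrite prodr_const card_ord.
have -> : 8 * n%:R = 5 * n%:R + n%:R * 3 :> R by ring.
rewrite expRD (expRM_natl n) ler_wpM2l ?expR_ge0//.
rewrite lerXn2r ?nnegrE ?expR_ge0// ?sumr_ge0// => [v _|]; first exact: expR_ge0.
apply: (@le_trans _ _ 8).
  rewrite -(pair_bigA _ (fun k b => expR (- signed_lev (k, b) ^+ 2)))/=.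
  under eq_bigr => k _ do rewrite big_bool !sqr_signed_lev/=.
  have : \sum_(k < L) (expR (- lev R k ^+ 2) + expR (- lev R k ^+ 2)) <=
    \sum_(k < L) 2 * (((k : nat) == 0%N)%:R + (lev R k)^-1).
    apply: ler_sum => -[[|k] kL] _; first by rewrite /= expr0n oppr0 expR0 invr0; lra.
    rewrite add0r; have := lev_ge1 R (ltn0Sn k); have := lev_gt0 R (ltn0Sn k).
    rewrite [nat_of_ord _]/=; move: (lev R k.+1) => x x0 x1.
    have : expR (- x ^+ 2) <= x^-1; last by lra.
    rewrite expRN lef_pV2 ?posrE ?expR_gt0//.
    by apply: le_trans (expR_ge1Dx _); nra.
  move=> /le_trans; apply; rewrite -mulr_sumr big_split/=.
  have := sum_inv_lev R L.
  have : \sum_(k < L) ((k : nat) == 0%N)%:R <= 1 :> R.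
    case: L => [|L']; first by rewrite big_ord0.
    by rewrite big_ord_recl/= big1 ?addr0.
  lra.
have := @expR1_ge2 R; have -> : 3 = 3%:R * 1 :> R by rewrite mulr1.
rewrite expRM_natl => e2.
have -> : 8 = 2 ^+ 3 :> R by ring.
by rewrite lerXn2r ?nnegrE ?expR_ge0.
Qed.

(** Lightness keeps the scaled coefficients at most 1, and p (5n)^2 / q^2 = 25n, so each pair costs
    at most exp(50n - 68n). The at most exp(16n) pairs leave exp(-2n) <= 1/4. *)
Lemma expect_light_cost : expect p light_cost <= 4^-1.
Proof.
have step (z w : {ffun 'I_n -> 'I_L * bool}) : lev_vec z -> lev_vec w ->
    expect p (fun f => expR (q^-1 * light_sum f z w - 68 * n%:R))
      <= expR (- (18 * n%:R)).
  move=> zT wT.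
  pose c (e : 'I_n * 'I_n) :=
    if `|signed_lev (z e.1) * signed_lev (w e.2)| <= q
    then q^-1 * (signed_lev (z e.1) * signed_lev (w e.2)) else 0.
  have c1 e : c e <= 1.
    rewrite /c; case: ifPn => // lq.
    rewrite mulrC ler_pdivrMr// mul1r; exact: le_trans (ler_norm _) lq.
  have -> : expect p (fun f => expR (q^-1 * light_sum f z w - 68 * n%:R)) =
      expR (- (68 * n%:R)) * expect p (fun f => expR (\sum_e c e * ((f e)%:R - p))).
    rewrite -expectZ; apply: eq_bigr => f _; congr (_ * _).
    rewrite -expRD addrC; congr (expR (_ + _)).
    rewrite /light_sum mulr_sumr big_mkcond; apply: eq_bigr => e _.
    by rewrite /c; case: ifP; rewrite ?mul0r// !mulrA.
  apply: le_trans (ler_wpM2l (expR_ge0 _) (expect_expR_centered p0 p1 c1)) _.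
  rewrite -expRD ler_expR.
  have : \sum_e c e ^+ 2 <= (q ^+ 2)^-1 * (5 * n%:R * (5 * n%:R)).
    apply: (@le_trans _ _ ((q ^+ 2)^-1 *
        ((\sum_i signed_lev (z i) ^+ 2) * (\sum_j signed_lev (w j) ^+ 2)))).
      rewrite big_distrlr/= pair_bigA/= mulr_sumr; apply: ler_sum => e _.
      rewrite /c; case: ifP => _; first by rewrite !exprMn exprVn.
      by rewrite expr0n; apply: mulr_ge0; [rewrite invr_ge0 sqr_ge0|rewrite mulr_ge0 ?sqr_ge0].
    rewrite ler_wpM2l ?invr_ge0 ?sqr_ge0//.
    by apply: ler_pM => //; apply: sumr_ge0 => i _; apply: sqr_ge0.
  have p2 : 0 <= 2 * p by rewrite mulr_ge0.
  move=> /(ler_wpM2l p2).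
  have -> : 2 * p * ((q ^+ 2)^-1 * (5 * n%:R * (5 * n%:R))) = 50 * n%:R.
    rewrite -pnq; have p_neq0 : p != 0.
      by apply: contraTneq q0 => pE; move: pnq; rewrite pE mul0r => /esym/eqP;
        rewrite sqrf_eq0 => /eqP ->; rewrite ltxx.
    by field; rewrite p_neq0 gt_eqF.
  lra.
rewrite expect_sum.
apply: (@le_trans _ _ (\sum_(zw | lev_vec zw.1 && lev_vec zw.2)
    expR (- (18 * n%:R)))).
  by apply: ler_sum => -[z w] /andP[zT wT]; apply: step.
rewrite -(pair_big_dep lev_vec (fun=> lev_vec) (fun _ _ => expR (- (18 * n%:R))))/=.
apply: (@le_trans _ _ (expR (8 * n%:R) * (expR (8 * n%:R) * expR (- (18 * n%:R))))).
  have -> : \sum_(z | lev_vec z) \sum_(w | lev_vec w) expR (- (18 * n%:R) : R) =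
      (\sum_(z | lev_vec z) 1) * ((\sum_(w | lev_vec w) 1) * expR (- (18 * n%:R))).
        rewrite mulr_suml; apply: eq_bigr => z _; rewrite mul1r mulr_suml.
    by apply: eq_bigr => w _; rewrite mul1r.
  rewrite ler_pM ?mulr_ge0 ?expR_ge0 ?sumr_ge0 ?card_lev_vec//.
  by rewrite ler_wpM2r ?expR_ge0 ?card_lev_vec.
rewrite -!expRD.
apply: (@le_trans _ _ (expR (- (2%:R * 1)))).
  have : 1 <= n%:R :> R by rewrite ler1n.
  by rewrite ler_expR; lra.
rewrite expRN expRM_natl lef_pV2 ?posrE ?exprn_gt0 ?expR_gt0//.
by have := @expR1_ge2 R; nra.
Qed.

(** As e <= 4, the moment of a rectangle at parameter 1 + ln t is at most exp(4p|I||J|t), which the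
    exponent cancels. The two entropy sums give 1/(4n^2) each, and the grid has at most 7n
    values. *)
Lemma expect_discrepancy_cost : (L <= 7 * n)%N -> expect p discrepancy_cost <= 2^-1.
Proof.
move=> Ln.
have step I J (j : 'I_L) : (0 < j)%N ->
    expect p (fun f => expR (discrepancy_exponent f I J j))
      <= expR (- (4 * ent R n #|I|)) * expR (- (4 * ent R n #|J|)).
  move=> j0; set t := lev R j.
  have t0 : 0 < t by apply: lev_gt0.
  pose inIJ (e : 'I_n * 'I_n) := (e.1 \in I) && (e.2 \in J).
  pose c e := if inIJ e then 1 + ln t else 0.
  pose X := 4 * (p * #|I|%:R * #|J|%:R * t) + 4 * ent R n #|I| + 4 * ent R n #|J|.
  have -> : expect p (fun f => expR (discrepancy_exponent f I J j)) =
      expR (- X) * expect p (fun f => expR (\sum_e c e * (f e)%:R)).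
    rewrite -expectZ; apply: eq_bigr => f _; congr (_ * _).
    rewrite -expRD [X in expR X = _]/discrepancy_exponent [X in _ = expR X]addrC.
    congr expR; congr (_ - _).
    rewrite /count_in mulr_sumr big_mkcond; apply: eq_bigr => e _.
    by rewrite /c /inIJ; case: ifP; rewrite ?mul0r.
  apply: le_trans (ler_wpM2l (expR_ge0 _) (expect_expR p0 p1 c)) _.
  rewrite -!expRD ler_expR.
  have : \sum_e (expR (c e) - 1) <= #|I|%:R * #|J|%:R * (4 * t).
    apply: (@le_trans _ _ (\sum_(e | inIJ e) 4 * t)).
      rewrite [leRHS]big_mkcond; apply: ler_sum => e _.
      rewrite /c; case: ifP => _; last by rewrite expR0 subrr.
      rewrite expRD lnK ?posrE//; have := @expR1_le4 R; nra.
    rewrite sumr_const -[leLHS]mulr_natl -natrM ler_wpM2r//.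
      by rewrite mulr_ge0// ltW.
    rewrite ler_nat -cardsX subset_leq_card//.
    by apply/subsetP => -[i k] ij; rewrite !inE.
  move=> /(ler_wpM2l p0); rewrite /X; lra.
rewrite expect_sum.
have Ge0 : 0 <= \sum_(I : {set 'I_n} | I != set0) expR (- (4 * ent R n #|I|)).
  by apply: sumr_ge0 => I _; apply: expR_ge0.
apply: (@le_trans _ _ (\sum_(j < L)
  ((\sum_(I : {set 'I_n} | I != set0) expR (- (4 * ent R n #|I|))) *
   (\sum_(J : {set 'I_n} | J != set0) expR (- (4 * ent R n #|J|)))))).
  rewrite big_mkcond; apply: ler_sum => j _; case: ifPn => j0; last exact: mulr_ge0.
  rewrite expect_sum big_distrlr/=; apply: ler_sum => I _.
  by rewrite expect_sum; apply: ler_sum => J _; apply: step.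
rewrite sumr_const card_ord -[leLHS]mulr_natl.
have G := sum_expR_ent R n0.
apply: (@le_trans _ _ ((7 * n%:R) * ((4 * n%:R ^+ 2)^-1 * (4 * n%:R ^+ 2)^-1))).
  apply: ler_pM; rewrite ?mulr_ge0//; last exact: ler_pM.
  by rewrite -natrM ler_nat.
have -> : 7 * n%:R * ((4 * n%:R ^+ 2)^-1 * (4 * n%:R ^+ 2)^-1) =
  7 / 16 / n%:R ^+ 3 :> R by field; rewrite gt_eqF.
rewrite ler_pdivrMr ?exprn_gt0//.
have : 1 <= n%:R ^+ 3 :> R by rewrite exprn_ege1// ler1n.
lra.
Qed.

(** The mean total cost is at most 3/4, so some outcome stays below 1; all terms being positive
    exponentials, every exponent is then at most 0. *)
Lemma good_sample_exists : (L <= 7 * n)%N -> exists f,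
  (forall z w, lev_vec z -> lev_vec w -> light_sum f z w <= 68 * q * n%:R) /\
  (forall I J (j : 'I_L), I != set0 -> J != set0 -> (0 < j)%N ->
    (1 + ln (lev R j)) * count_in f I J <=
    4 * (p * #|I|%:R * #|J|%:R * lev R j) + 4 * ent R n #|I| + 4 * ent R n #|J|).
Proof.
move=> Ln.
have : expect p (fun f => light_cost f + discrepancy_cost f) < 1.
  rewrite expectD; have := expect_light_cost; have := expect_discrepancy_cost Ln.
  lra.
case/(expect_lt1_exists p0 p1) => f fcost; exists f.
have le0 (x : R) : expR x < 1 -> x <= 0 by rewrite -[ltRHS](@expR0 R) ltr_expR => /ltW.
have lc0 : 0 <= light_cost f by apply: sumr_ge0 => i _; apply: expR_ge0.
have dc0 : 0 <= discrepancy_cost f.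
  by do 3!apply: sumr_ge0 => ? _; apply: expR_ge0.
split=> [z w zT wT|I J j I0 J0 j0].
  have : q^-1 * light_sum f z w - 68 * n%:R <= 0.
    apply/le0/(le_lt_trans _ fcost).
    rewrite /light_cost (bigD1 (z, w))/=; last by rewrite zT.
    rewrite -addrA lerDl addr_ge0// sumr_ge0// => ? _; exact: expR_ge0.
  rewrite subr_le0 mulrC ler_pdivrMr// => /le_trans; apply.
  by rewrite mulrAC.
rewrite -subr_le0; apply/le0/(le_lt_trans _ fcost).
rewrite /discrepancy_cost (bigD1 j)//= (bigD1 I)//= (bigD1 J)//=.
apply: ler_wpDl => //; do 3!(apply: ler_wpDr;
  first by do ?[apply: sumr_ge0 => ? _]; apply: expR_ge0).
exact: lexx.
Qed.

End RandomSample.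

(** * Heavy pairs of a sample with bounded degrees *)

Section HeavyPairs.
Variables (R : realType) (n L : nat) (p q : R) (f : {ffun 'I_n * 'I_n -> bool}).
Hypotheses (n0 : (0 < n)%N) (L2 : (1 < L)%N) (p0 : 0 <= p) (q1 : 1 <= q).
Hypothesis pnq : p * n%:R = q ^+ 2.
Hypothesis disc : forall (I J : {set 'I_n}) (j : 'I_L),
  I != set0 -> J != set0 -> (0 < j)%N ->
  (1 + ln (lev R j)) * count_in R f I J <=
  4 * (p * #|I|%:R * #|J|%:R * lev R j) + 4 * ent R n #|I| + 4 * ent R n #|J|.
Variables a b : 'I_n -> 'I_L.
Hypothesis a2 : \sum_i lev R (a i) ^+ 2 <= 5 * n%:R.
Hypothesis b2 : \sum_i lev R (b i) ^+ 2 <= 5 * n%:R.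
Hypothesis adeg : forall i, (0 < a i)%N -> \sum_j (f (i, j))%:R <= 12 * q ^+ 2.
Hypothesis bdeg : forall j, (0 < b j)%N -> \sum_i (f (i, j))%:R <= 12 * q ^+ 2.

Let q0 : 0 < q. Proof. exact: lt_le_trans q1. Qed.

Let A (i : 'I_n) : R := lev R (a i).
Let B (j : 'I_n) : R := lev R (b j).
Let comparable_pair (x y : R) := [&& q < x * y, x < y * q & y < x * q].

Lemma level_set_sum (c : 'I_n -> 'I_L) :
  \sum_(k < L) lev R k ^+ 2 * #|[set i | c i == k]|%:R = \sum_i lev R (c i) ^+ 2.
Proof.
rewrite [RHS](partition_big c predT)//=; apply: eq_bigr => k _.
rewrite (eq_bigr (fun=> lev R k ^+ 2)); last by move=> i /eqP ->.
rewrite sumr_const mulr_natr; congr (_ *+ _).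
by apply: eq_card => i; rewrite inE.
Qed.

Definition level_grid (t : R) := exists2 j : 'I_L, (0 < j)%N & t = lev R j.

Lemma level_grid1 : level_grid 1.
Proof. by exists (Ordinal L2). Qed.

Lemma level_grid_max s t : level_grid s -> level_grid t -> level_grid (Num.max s t).
Proof. by move=> hs ht; rewrite /Num.max; case: ifP. Qed.

(* The grid parameter for the levels x and y: at most x y / q on comparable pairs, yet
   large enough for its logarithm to absorb the entropy of the level sets. *)
Let tt (x y : R) := Num.max (if q <= y then x else 1) (if q <= x then y else 1).

(** This is [disc] at t = [tt x y], multiplied by xy / (1 + ln t). As t <= xy / q, the mean term is
    at most (4p/q) x^2 |I| y^2 |J|; the entropy terms stay divided by 1 + ln t. *)
Lemma comparable_level_bound (k l : 'I_L) :
    comparable_pair (lev R k) (lev R l) ->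
  lev R k * lev R l * count_in R f [set i | a i == k] [set j | b j == l] <=
  4 * p / q * ((lev R k ^+ 2 * #|[set i | a i == k]|%:R) *
               (lev R l ^+ 2 * #|[set j | b j == l]|%:R)) +
  4 * (lev R k * lev R l *
     (ent R n #|[set i | a i == k]| / (1 + ln (tt (lev R k) (lev R l))))) +
  4 * (lev R l * lev R k *
     (ent R n #|[set j | b j == l]| / (1 + ln (tt (lev R k) (lev R l))))).
Proof.
set I := [set i | _]; set J := [set j | _].
case/and3P => qxy xy yx.
have x0 : 0 < lev R k.
  rewrite lt_def lev_ge0 andbT; apply: contraTneq qxy => ->.
  by rewrite mul0r -leNgt ltW.
have y0 : 0 < lev R l.
  rewrite lt_def lev_ge0 andbT; apply: contraTneq qxy => ->.
  by rewrite mulr0 -leNgt ltW.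
have k0 : (0 < k)%N by case: (nat_of_ord k) x0 => //=; rewrite ltxx.
have l0 : (0 < l)%N by case: (nat_of_ord l) y0 => //=; rewrite ltxx.
set t := tt _ _.
have t1 : 1 <= t.
  by rewrite /t /tt le_max; apply/orP; left; case: ifP => // _; apply: lev_ge1.
(* A level x enters the maximum only if q <= y, so x q <= x y, and symmetrically for y; for the
   value 1, q < x y is enough. *)
have tq : t * q <= lev R k * lev R l.
  rewrite -ler_pdivlMr// /t /tt ge_max !ler_pdivlMr//; apply/andP; split; case: ifP => qle.
  - by rewrite ler_pM2l.
  - by rewrite mul1r ltW.
  - by rewrite mulrC ler_pM2r.
  - by rewrite mul1r ltW.
have [j j0 tj] : level_grid t.
  by apply: level_grid_max; case: ifP => _; (exact: level_grid1 || by [exists k|exists l]).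
have th0 : 0 < 1 + ln t by rewrite ltr_pwDl// ln_ge0.
have In : (#|I| <= n)%N by rewrite -[X in (_ <= X)%N](card_ord n) max_card.
have Jn : (#|J| <= n)%N by rewrite -[X in (_ <= X)%N](card_ord n) max_card.
have eI := ent_ge0 R In; have eJ := ent_ge0 R Jn.
have xy0 : 0 < lev R k * lev R l by rewrite mulr_gt0.
set h := 1 + ln t in th0 *.
have c0 : 0 <= count_in R f I J by apply: sumr_ge0.
have [/andP[I0 J0]|] := boolP ((I != set0) && (J != set0)); last first.
  rewrite negb_and !negbK => IJ.
  have -> : count_in R f I J = 0.
    rewrite /count_in big_pred0// => e.
    by case/orP: IJ => /eqP ->; rewrite in_set0 ?andbF.
  have hV : 0 <= h^-1 by rewrite invr_ge0 ltW.
  rewrite mulr0; apply: addr_ge0; first apply: addr_ge0.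
  - by rewrite !mulr_ge0 ?invr_ge0 ?sqr_ge0 // ?ltW.
  - apply: mulr_ge0 => //; apply: mulr_ge0; [exact: ltW|exact: mulr_ge0].
  - apply: mulr_ge0 => //; rewrite (mulrC (lev R l)).
    by apply: mulr_ge0; [exact: ltW|exact: mulr_ge0].
have := disc I0 J0 j0; rewrite -tj -/h.
move: (count_in R f I J) (ent R n #|I|) (ent R n #|J|) (#|I|%:R : R) (#|J|%:R : R) c0 eI eJ
  (ler0n R #|I|) (ler0n R #|J|) => c e1 e2 u v c0 e10 e20 u0 v0 hc.
move: x0 y0 tq xy0; move: (lev R k) (lev R l) => x y x0 y0 tq xy0.
have -> : 4 * p / q * (x ^+ 2 * u * (y ^+ 2 * v)) +
    4 * (x * y * (e1 / h)) + 4 * (y * x * (e2 / h)) =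
  x * y / h * (4 * (p * u * v * (x * y / q * h)) + 4 * e1 + 4 * e2).
  by field; rewrite (gt_eqF q0) (gt_eqF th0).
have -> : x * y * c = x * y / h * (h * c) by field; rewrite (gt_eqF th0).
rewrite ler_pM2l ?divr_gt0//; apply: (le_trans hc).
rewrite !lerD2r ler_pM2l// ler_wpM2l ?mulr_ge0//.
apply: (@le_trans _ _ (x * y / q)); first by rewrite ler_pdivlMr.
by apply: ler_peMr; [rewrite divr_ge0 ?ltW|rewrite /h lerDl ln_ge0].
Qed.

(** Summed over pairs of levels, the mean terms give (4p/q)(5n)^2 = 100qn, and each of the two
    entropy sums gives 4 * 68qn. *)
Lemma comparable_pairs_sum :
  \sum_(e | comparable_pair (A e.1) (B e.2)) A e.1 * B e.2 * (f e)%:R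
    <= 644 * q * n%:R.
Proof.
pose I k := [set i | a i == k]; pose J l := [set j | b j == l].
rewrite (partition_big (fun e : 'I_n * 'I_n => (a e.1, b e.2))
  (fun kl => comparable_pair (lev R kl.1) (lev R kl.2)))//=.
have -> : \sum_(kl : 'I_L * 'I_L | comparable_pair (lev R kl.1) (lev R kl.2))
    \sum_(e | comparable_pair (A e.1) (B e.2) && ((a e.1, b e.2) == kl))
       A e.1 * B e.2 * (f e)%:R =
  \sum_(kl : 'I_L * 'I_L | comparable_pair (lev R kl.1) (lev R kl.2))
     lev R kl.1 * lev R kl.2 * count_in R f (I kl.1) (J kl.2).
  apply: eq_bigr => -[k l] /= kl; rewrite /count_in mulr_sumr.
  apply: eq_big => [e|e].
    rewrite !inE xpair_eqE; apply: andb_idl => /andP[/eqP ek /eqP el].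
    by rewrite /A /B ek el.
  by case/andP=> _ /eqP[] ek el; rewrite /A /B ek el.
pose th (k l : 'I_L) := 1 + ln (tt (lev R k) (lev R l)).
have tt1 x y : 1 <= tt x y.
  rewrite /tt le_max; case: (leP q x) => qx; last by rewrite lexx orbT.
  by case: ifP => _; rewrite ?lexx// (le_trans q1 qx).
have th1 k l : 1 <= th k l by rewrite lerDl ln_ge0.
have thl (k l : 'I_L) : (0 < k)%N -> q <= lev R l -> 1 + ln (lev R k) <= th k l.
  move=> k0 ql; rewrite lerD2l ler_ln ?posrE ?lev_gt0//; last exact: lt_le_trans (tt1 _ _).
  by rewrite /tt ql le_max lexx.
have thr (l k : 'I_L) : (0 < l)%N -> q <= lev R k -> 1 + ln (lev R l) <= th k l.
  move=> l0 qk; rewrite lerD2l ler_ln ?posrE ?lev_gt0//; last exact: lt_le_trans (tt1 _ _).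
  by rewrite /tt qk le_max lexx orbT.
have cardn (c : 'I_n -> 'I_L) k : (#|[set i | c i == k]| <= n)%N.
  by rewrite -[X in (_ <= X)%N](card_ord n) max_card.
have sI := level_set_sum a; have sJ := level_set_sum b.
have HI := sum_level_entropy n0 q1 (cardn a) (eq_ind_r (fun x => x <= _) a2 sI) th1 thl.
have HJ := sum_level_entropy n0 q1 (cardn b) (eq_ind_r (fun x => x <= _) b2 sJ)
  (fun l k => th1 k l) thr.
have lev_pos (k : 'I_L) : 0 < lev R k -> (0 < k)%N by case: k => -[|k] //=; rewrite ltxx.
have cpos k l : comparable_pair (lev R k) (lev R l) -> (0 < k)%N && (0 < l)%N.
  case: k => [|k]; first by rewrite /comparable_pair /= mul0r ltNge ltW.
  by case: l => [|l] //; rewrite /comparable_pair /= mulr0 ltNge ltW.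
have eI k := ent_ge0 R (cardn a k); have eJ k := ent_ge0 R (cardn b k).
have th0 k l : 0 <= (th k l)^-1 by rewrite invr_ge0 (le_trans _ (th1 k l)).
apply: (@le_trans _ _ (\sum_(kl : 'I_L * 'I_L | comparable_pair (lev R kl.1) (lev R kl.2))
  (4 * p / q * ((lev R kl.1 ^+ 2 * #|I kl.1|%:R) * (lev R kl.2 ^+ 2 * #|J kl.2|%:R)) +
   4 * (lev R kl.1 * lev R kl.2 * (ent R n #|I kl.1| / th kl.1 kl.2)) +
   4 * (lev R kl.2 * lev R kl.1 * (ent R n #|J kl.2| / th kl.1 kl.2))))).
  by apply: ler_sum => -[k l] /= kl; apply: comparable_level_bound.
rewrite !big_split/= -!mulr_sumr.
have -> : 644 * q * n%:R =
  4 * p / q * (5 * n%:R * (5 * n%:R)) + 4 * (68 * q * n%:R) + 4 * (68 * q * n%:R).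
  have -> : 4 * p / q * (5 * n%:R * (5 * n%:R)) = 100 * n%:R * (p * n%:R) / q by ring.
  by rewrite pnq; field; rewrite gt_eqF.
apply: lerD; first apply: lerD.
- rewrite ler_wpM2l//; first by rewrite !mulr_ge0// invr_ge0 ltW.
  apply: (@le_trans _ _ ((\sum_(k < L) lev R k ^+ 2 * #|I k|%:R) *
      (\sum_(l < L) lev R l ^+ 2 * #|J l|%:R))).
    rewrite big_distrlr/= pair_bigA/= big_mkcond; apply: ler_sum => -[k l] _ /=.
    by case: ifP => // _; rewrite !mulr_ge0 ?lev_ge0.
  rewrite /I /J sI sJ; apply: ler_pM => //; apply: sumr_ge0 => i _; exact: sqr_ge0.
- rewrite ler_pM2l//; apply: le_trans HI.
  rewrite pair_big_dep/= [leLHS]big_mkcond [leRHS]big_mkcond/=.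
  apply: ler_sum => -[k l] _ /=; case: ifPn => [kl|_].
    have /andP[-> _] := cpos _ _ kl.
    by case/and3P: kl => _ _ ->.
  case: ifP => // _; apply: mulr_ge0; first by rewrite mulr_ge0 ?lev_ge0.
  exact: mulr_ge0.
- rewrite ler_pM2l//; apply: le_trans HJ.
  rewrite pair_big_dep/= [leLHS]big_mkcond [leRHS]big_mkcond/=.
  (* In [HJ] the column level is the outer index, hence the exchange. *)
  have swap_inj : injective (fun kl : 'I_L * 'I_L => (kl.2, kl.1)).
    by move=> [? ?] [? ?] /= [-> ->].
  rewrite [leRHS](reindex_inj swap_inj)/=.
  apply: ler_sum => -[k l] _ /=; case: ifPn => [kl|_].
    have /andP[_ ->] := cpos _ _ kl.
    by case/and3P: kl => _ -> _.
  case: ifP => // _; apply: mulr_ge0; first by rewrite mulr_ge0 ?lev_ge0.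
  exact: mulr_ge0.
Qed.

(** If x >= q y then xy <= x^2 / q, and the row degree bound sums this to 12q * 5n = 60qn; columns
    are symmetric, and comparable pairs add 644qn. *)
Lemma heavy_pairs_sum :
  \sum_(e | q < A e.1 * B e.2) A e.1 * B e.2 * (f e)%:R <= 764 * q * n%:R.
Proof.
have degree_sum (c : 'I_n -> 'I_L) (g : 'I_n -> 'I_n -> bool) :
    (forall i, (0 < c i)%N -> \sum_j (g i j)%:R <= 12 * q ^+ 2) ->
    \sum_i lev R (c i) ^+ 2 <= 5 * n%:R ->
    \sum_i \sum_j q^-1 * (lev R (c i) ^+ 2 * (g i j)%:R) <= 60 * q * n%:R.
  move=> deg c2.
  apply: (@le_trans _ _ (\sum_i 12 * q * lev R (c i) ^+ 2)).
    apply: ler_sum => i _; rewrite -!mulr_sumr.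
    (* An index at level 0 has no degree bound, but its weight is 0. *)
    have [ci|] := posnP (c i).
      by rewrite ci /= expr0n /= mul0r !mulr0.
    move=> /deg /(ler_wpM2l (sqr_ge0 (lev R (c i)))) h.
    rewrite mulrC ler_pdivrMr//; apply: (le_trans h).
    by rewrite le_eqVlt; apply/orP; left; apply/eqP; ring.
  rewrite -mulr_sumr; have q12 : 0 <= 12 * q by rewrite mulr_ge0 ?ltW.
  by apply: (le_trans (ler_wpM2l q12 c2)); lra.
have sA := degree_sum a (fun i j => f (i, j)) adeg a2.
have sB := degree_sum b (fun j i => f (i, j)) bdeg b2.
rewrite exchange_big/= in sB; rewrite !pair_bigA/= in sA sB.
have sC := comparable_pairs_sum.
apply: (@le_trans _ _ (60 * q * n%:R + 60 * q * n%:R + 644 * q * n%:R)); last lra.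
apply: le_trans (lerD (lerD sA sB) sC).
rewrite [X in _ <= _ + X]big_mkcond -!big_split/= [leLHS]big_mkcond.
apply: ler_sum => -[i j] _ /=.
have Ai : 0 <= A i := lev_ge0 _ _; have Bj : 0 <= B j := lev_ge0 _ _.
have fij : 0 <= (f (i, j))%:R :> R by [].
rewrite -/(A i) -/(B j).
move: (A i) (B j) ((f (i, j))%:R : R) Ai Bj fij => x y z x0 y0 z0.
have qV : 0 <= q^-1 by rewrite invr_ge0 ltW.
have xz : 0 <= q^-1 * (x ^+ 2 * z) by rewrite !mulr_ge0.
have yz : 0 <= q^-1 * (y ^+ 2 * z) by rewrite !mulr_ge0.
rewrite /comparable_pair; case: (ltP q (x * y)) => /= _; last first.
  by rewrite addr0 addr_ge0.
case: (ltP x (y * q)) => [_|xy]; last first.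
  rewrite addr0; apply: ler_wpDr => //.
  rewrite [leRHS]mulrC ler_pdivlMr//.
  by have := ler_wpM2r (mulr_ge0 x0 z0) xy; lra.
case: (ltP y (x * q)) => [_|yx]; first by rewrite ler_wpDl// addr_ge0.
rewrite addr0; apply: ler_wpDl => //.
rewrite [leRHS]mulrC ler_pdivlMr//.
by have := ler_wpM2r (mulr_ge0 y0 z0) yx; lra.
Qed.

End HeavyPairs.

(** * Rounding real vectors to signed levels *)

Section Rounding.
Variables (R : realType) (n L : nat).
Hypothesis nL : (n.+3 <= L)%N.

(** Up to 1 the bracket is 0, 1; beyond, it is 2^m <= x < 2^(m+1), at levels m + 1 and m + 2. Since
    x <= x^2 <= n < 2^n, no level above n + 1 occurs. *)
Lemma lev_bracket (x : R) : 0 <= x -> x ^+ 2 <= n%:R ->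
  exists k l : 'I_L, [/\ lev R k <= x, x <= lev R l & lev R l ^+ 2 <= 1 + 4 * x ^+ 2].
Proof.
move=> x0 xn.
have [x1|x1] := leP x 1.
  have L0 : (0 < L)%N by lia.
  have L1 : (1 < L)%N by lia.
  exists (Ordinal L0), (Ordinal L1); split=> //=.
  by rewrite expr0 expr1n lerDl mulr_ge0 ?sqr_ge0.
have xlt : x < 2 ^+ n.
  apply: (@le_lt_trans _ _ (x ^+ 2)); first by rewrite expr2 ler_peMl// ltW.
  by apply: (le_lt_trans xn); rewrite -natrX ltr_nat ltn_expl.
case: (ex_minnP (ex_intro (fun m => x < 2 ^+ m) n xlt)) => -[|m] xm mmin.
  by move: xm; rewrite expr0 ltNge ltW.
have mn : (m < n)%N by exact: mmin.
have mx : 2 ^+ m <= x by rewrite leNgt; apply/negP => /mmin; rewrite ltnn.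
have kL : (m.+1 < L)%N by lia.
have lL : (m.+2 < L)%N by lia.
exists (Ordinal kL), (Ordinal lL); split=> //=; first exact: ltW.
have m0 : 0 <= 2 ^+ m :> R by rewrite exprn_ge0.
rewrite (exprS _ m) exprMn; have : (2 ^+ m) ^+ 2 <= x ^+ 2 by rewrite lerXn2r.
by lra.
Qed.

(* A linear function is at least as large at one of the two ends of the bracket of x. *)
Lemma signed_lev_rounding (c x : R) : x ^+ 2 <= n%:R ->
  exists v : 'I_L * bool,
    c * x <= c * signed_lev R v /\ signed_lev R v ^+ 2 <= 1 + 4 * x ^+ 2.
Proof.
move=> xn; have xE : x = (-1) ^+ (x < 0)%R * `|x| by rewrite -numEsign.
have xn' : `|x| ^+ 2 <= n%:R by rewrite real_normK ?num_real.
have [k [l [kx xl l2]]] := lev_bracket (normr_ge0 x) xn'.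
have [c0|c0] := leP 0 (c * (-1) ^+ (x < 0)%R).
  exists (l, x < 0); rewrite sqr_signed_lev/=; split; last first.
    by move: l2; rewrite real_normK ?num_real.
  by rewrite {1}xE /signed_lev/= !mulrA ler_wpM2l.
exists (k, x < 0); rewrite sqr_signed_lev/=; split.
  by rewrite {1}xE /signed_lev/= !mulrA ler_wnM2l// ltW.
apply: (@le_trans _ _ (`|x| ^+ 2)); first by rewrite lerXn2r ?nnegrE ?lev_ge0.
by rewrite real_normK ?num_real//; have := sqr_ge0 x; lra.
Qed.

(** A linear function can be rounded one coordinate at a time, and the new squared norm is at most n
    + 4n. *)
Lemma lev_vec_rounding (c x : 'I_n -> R) : \sum_i x i ^+ 2 <= n%:R ->
  exists2 z : {ffun 'I_n -> 'I_L * bool}, lev_vec R z &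
    \sum_i c i * x i <= \sum_i c i * signed_lev R (z i).
Proof.
move=> xn.
have xi i : x i ^+ 2 <= n%:R.
  by apply: le_trans xn; rewrite (bigD1 i)//= lerDl sumr_ge0// => j _; apply: sqr_ge0.
have [z zP] := fin_all_exists (fun i => signed_lev_rounding (c i) (xi i)).
exists (finfun z); last by apply: ler_sum => i _; rewrite ffunE; case: (zP i).
rewrite /lev_vec; apply: (@le_trans _ _ (\sum_i (1 + 4 * x i ^+ 2))).
  by apply: ler_sum => i _; rewrite ffunE; case: (zP i).
rewrite big_split/= sumr_const card_ord -mulr_sumr.
by rewrite -[1 *+ n]/(n%:R); lra.
Qed.

End Rounding.

(** * The centred bilinear form on good rows and columns *)

Section PrunedForm.
Variables (R : realType) (n L : nat) (p q : R) (f : {ffun 'I_n * 'I_n -> bool}).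
Hypotheses (n0 : (0 < n)%N) (nL : (n.+3 <= L)%N) (p0 : 0 <= p) (q1 : 1 <= q).
Hypothesis pnq : p * n%:R = q ^+ 2.
Hypothesis light : forall z w : {ffun 'I_n -> 'I_L * bool},
  lev_vec R z -> lev_vec R w -> light_sum p q f z w <= 68 * q * n%:R.
Hypothesis disc : forall (I J : {set 'I_n}) (j : 'I_L),
  I != set0 -> J != set0 -> (0 < j)%N ->
  (1 + ln (lev R j)) * count_in R f I J <=
  4 * (p * #|I|%:R * #|J|%:R * lev R j) + 4 * ent R n #|I| + 4 * ent R n #|J|.

Let q0 : 0 < q. Proof. exact: lt_le_trans q1. Qed.
Let L2 : (1 < L)%N. Proof. by lia. Qed.

Definition good_rows := [set i | \sum_j (f (i, j))%:R <= 12 * q ^+ 2].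
Definition good_cols := [set j | \sum_i (f (i, j))%:R <= 12 * q ^+ 2].
Definition good_pair (e : 'I_n * 'I_n) := (e.1 \in good_rows) && (e.2 \in good_cols).

Lemma count_inE (I J : {set 'I_n}) :
  count_in R f I J = \sum_(i in I) \sum_(j in J) (f (i, j))%:R.
Proof. by rewrite pair_big_dep/=; apply: eq_bigr => -[i j]. Qed.

(** Take [disc] at t = 1 with one side full: the mean term is q^2 m and each entropy is at most n,
    so 12 q^2 m <= 4 q^2 m + 8n. The minimum m is the size of the other side, which covers rows and
    columns at once. *)
Lemma count_bad (I J : {set 'I_n}) : (I == setT) || (J == setT) ->
  12 * q ^+ 2 * Num.min #|I|%:R #|J|%:R <= count_in R f I J ->
  q ^+ 2 * Num.min #|I|%:R #|J|%:R <= n%:R.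
Proof.
move=> IJT; set m := Num.min _ _ => cnt.
have [/andP[I0 J0]|] := boolP ((I != set0) && (J != set0)); last first.
  rewrite negb_and !negbK => IJ0; have -> : m = 0; last by rewrite mulr0.
  by rewrite /m; case/orP: IJ0 => /eqP ->; rewrite cards0; [rewrite min_l|rewrite min_r].
have := disc (j := Ordinal L2) I0 J0 isT.
rewrite /= expr0 ln1 addr0 mul1r mulr1 => dIJ.
have In : (#|I| <= n)%N by rewrite -[X in (_ <= X)%N](card_ord n) max_card.
have Jn : (#|J| <= n)%N by rewrite -[X in (_ <= X)%N](card_ord n) max_card.
have eI := ent_le R In; have eJ := ent_le R Jn.
have mE : p * #|I|%:R * #|J|%:R = q ^+ 2 * m.
  rewrite -pnq /m; case/orP: IJT => /eqP ->; rewrite cardsT card_ord.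
    by rewrite min_r ?ler_nat.
  by rewrite min_l ?ler_nat// mulrAC.
rewrite mE in dIJ; lra.
Qed.

Lemma bad_rows_bound : q ^+ 2 * #|~: good_rows|%:R <= n%:R.
Proof.
have mE : Num.min #|~: good_rows|%:R #|[set: 'I_n]|%:R = #|~: good_rows|%:R :> R.
  by rewrite min_l// ler_nat subset_leq_card// subsetT.
rewrite -mE; apply: count_bad; rewrite ?eqxx ?orbT// mE.
rewrite count_inE.
rewrite mulr_natr -sumr_const; apply: ler_sum => i.
rewrite !inE -ltNge => /ltW /le_trans; apply.
by rewrite le_eqVlt; apply/orP; left; apply/eqP; apply: eq_bigl => j; rewrite inE.
Qed.

Lemma bad_cols_bound : q ^+ 2 * #|~: good_cols|%:R <= n%:R.
Proof.
have mE : Num.min #|[set: 'I_n]|%:R #|~: good_cols|%:R = #|~: good_cols|%:R :> R.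
  by rewrite min_r// ler_nat subset_leq_card// subsetT.
rewrite -mE; apply: count_bad; rewrite ?eqxx// mE.
rewrite count_inE.
rewrite exchange_big/= mulr_natr -sumr_const; apply: ler_sum => j.
rewrite !inE -ltNge => /ltW /le_trans; apply.
by rewrite le_eqVlt; apply/orP; left; apply/eqP; apply: eq_bigl => i; rewrite inE.
Qed.

(** Sending bad rows and columns to level 0 turns the sum over good pairs into a full sum for
    vectors that meet the degree hypotheses. Light pairs give 68, sampled heavy pairs 764 and their
    mean 25. *)
Lemma pruned_form_lev (z w : {ffun 'I_n -> 'I_L * bool}) :
  lev_vec R z -> lev_vec R w ->
  \sum_(e | good_pair e) signed_lev R (z e.1) * signed_lev R (w e.2) * ((f e)%:R - p)
    <= 857 * q * n%:R.
Proof.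
move=> zT wT.
have L0 : (0 < L)%N by apply: ltn_trans L2.
pose mask (G : {set 'I_n}) (u : {ffun 'I_n -> 'I_L * bool}) : {ffun 'I_n -> 'I_L * bool} :=
  [ffun i => if i \in G then u i else (Ordinal L0, false)].
have sl0 : signed_lev R (Ordinal L0, false) = 0 by rewrite /signed_lev mulr0.
have maskE G u i : signed_lev R (mask G u i) = if i \in G then signed_lev R (u i) else 0.
  by rewrite ffunE; case: ifP.
have maskT G u : lev_vec R u -> lev_vec R (mask G u).
  apply: le_trans; apply: ler_sum => i _; rewrite maskE.
  by case: ifP => // _; rewrite expr0n sqr_ge0.
have maskP G u i : (0 < (mask G u i).1)%N -> i \in G by rewrite ffunE; case: ifP.
set z' := mask good_rows z; set w' := mask good_cols w.
have z'T : lev_vec R z' by exact: maskT.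
have w'T : lev_vec R w' by exact: maskT.
have -> : \sum_(e | good_pair e) signed_lev R (z e.1) * signed_lev R (w e.2) * ((f e)%:R - p)
    = \sum_e signed_lev R (z' e.1) * signed_lev R (w' e.2) * ((f e)%:R - p).
  rewrite big_mkcond; apply: eq_bigr => e _; rewrite !maskE /good_pair.
  by case: ifP => [/andP[-> ->]//|/negbT]; rewrite negb_and => /orP[] /negbTE ->;
    rewrite ?mulr0 ?mul0r.
have norm_sl v : `|signed_lev R v| = lev R v.1.
  by rewrite /signed_lev normrM normrX normrN1 expr1n mul1r ger0_norm ?lev_ge0.
pose A i := lev R (z' i).1; pose B j := lev R (w' j).1.
have normAB e : `|signed_lev R (z' e.1) * signed_lev R (w' e.2)| = A e.1 * B e.2.
  by rewrite normrM !norm_sl.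
have A2 : \sum_i A i ^+ 2 <= 5 * n%:R.
  by under eq_bigr do rewrite /A -sqr_signed_lev.
have B2 : \sum_i B i ^+ 2 <= 5 * n%:R.
  by under eq_bigr do rewrite /B -sqr_signed_lev.
have Adeg i : (0 < (z' i).1)%N -> \sum_j (f (i, j))%:R <= 12 * q ^+ 2.
  by move/maskP; rewrite inE.
have Bdeg j : (0 < (w' j).1)%N -> \sum_i (f (i, j))%:R <= 12 * q ^+ 2.
  by move/maskP; rewrite inE.
have heavy : \sum_(e | q < A e.1 * B e.2) A e.1 * B e.2 * (f e)%:R <= 764 * q * n%:R :=
  heavy_pairs_sum n0 L2 p0 q1 pnq disc A2 B2 Adeg Bdeg.
have mean : p * \sum_(e | q < A e.1 * B e.2) A e.1 * B e.2 <= 25 * q * n%:R.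
  (* On heavy pairs q < AB, hence AB <= (AB)^2 / q. *)
  have AB : \sum_(e | q < A e.1 * B e.2) A e.1 * B e.2 <= q^-1 * (5 * n%:R * (5 * n%:R)).
    apply: (@le_trans _ _ (q^-1 * ((\sum_i A i ^+ 2) * (\sum_j B j ^+ 2)))).
      rewrite big_distrlr/= pair_bigA/= mulr_sumr big_mkcond; apply: ler_sum => e _.
      have Ai : 0 <= A e.1 := lev_ge0 _ _; have Bj : 0 <= B e.2 := lev_ge0 _ _.
      case: ifP => [qAB|_]; last by rewrite !mulr_ge0 ?invr_ge0 ?(ltW q0).
      rewrite [leRHS]mulrC ler_pdivlMr// -exprMn expr2.
      by apply: ler_wpM2l; [exact: mulr_ge0|exact: ltW].
    apply: ler_wpM2l; first by rewrite invr_ge0 ltW.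
    by apply: ler_pM => //; apply: sumr_ge0 => i _; apply: sqr_ge0.
  apply: (le_trans (ler_wpM2l p0 AB)).
  have -> : p * (q^-1 * (5 * n%:R * (5 * n%:R))) = 25 * n%:R * (p * n%:R) / q by ring.
  by rewrite pnq le_eqVlt; apply/orP; left; apply/eqP; field; rewrite gt_eqF.
rewrite (bigID (fun e => `|signed_lev R (z' e.1) * signed_lev R (w' e.2)| <= q))/=.
have hS1 := light z'T w'T.
suff : \sum_(e | ~~ (`|signed_lev R (z' e.1) * signed_lev R (w' e.2)| <= q))
     signed_lev R (z' e.1) * signed_lev R (w' e.2) * ((f e)%:R - p) <=
   \sum_(e | q < A e.1 * B e.2) A e.1 * B e.2 * (f e)%:R +
   p * \sum_(e | q < A e.1 * B e.2) A e.1 * B e.2.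
  move=> h2; apply: (le_trans (lerD hS1 (le_trans h2 (lerD heavy mean)))); lra.
rewrite mulr_sumr -big_split/= (eq_bigl (fun e => q < A e.1 * B e.2)); last first.
  by move=> e; rewrite normAB -ltNge.
apply: ler_sum => e _; rewrite -normAB.
move: (signed_lev R _ * signed_lev R _) => s.
have s1 := ler_norm s; have s2 : - s <= `|s| by rewrite -normrN ler_norm.
have f0 : 0 <= (f e)%:R :> R by [].
have := ler_wpM2r f0 s1; have := ler_wpM2r p0 s2; lra.
Qed.

(** The form is linear in each vector: x is rounded with y fixed, then y with the rounded x fixed,
    and neither step decreases the value. *)
Lemma pruned_form_unit (x y : 'I_n -> R) :
  \sum_i x i ^+ 2 <= n%:R -> \sum_i y i ^+ 2 <= n%:R ->
  \sum_(e | good_pair e) x e.1 * y e.2 * ((f e)%:R - p) <= 857 * q * n%:R.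
Proof.
pose M i j : R := if good_pair (i, j) then (f (i, j))%:R - p else 0.
have formE (u v : 'I_n -> R) : \sum_(e | good_pair e) u e.1 * v e.2 * ((f e)%:R - p) =
    \sum_i \sum_j u i * v j * M i j.
  rewrite pair_bigA/= big_mkcond; apply: eq_bigr => -[i j] _ /=.
  by rewrite /M; case: ifP => //; rewrite mulr0.
move=> xn yn; rewrite formE.
have [z zT zle] := lev_vec_rounding nL (fun i => \sum_j y j * M i j) xn.
have [w wT wle] := lev_vec_rounding nL (fun j => \sum_i signed_lev R (z i) * M i j) yn.
have := pruned_form_lev zT wT.
rewrite (formE (fun i => signed_lev R (z i)) (fun j => signed_lev R (w j))).
apply: le_trans.
apply: (@le_trans _ _ (\sum_i (\sum_j y j * M i j) * x i)).
  rewrite le_eqVlt; apply/orP; left; apply/eqP; apply: eq_bigr => i _.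
  by rewrite mulr_suml; apply: eq_bigr => j _; ring.
apply: (le_trans zle).
apply: (@le_trans _ _ (\sum_j (\sum_i signed_lev R (z i) * M i j) * y j)).
  rewrite le_eqVlt; apply/orP; left; apply/eqP.
  under eq_bigr do rewrite mulr_suml.
  rewrite exchange_big/=; apply: eq_bigr => j _.
  by rewrite mulr_suml; apply: eq_bigr => i _; ring.
apply: (le_trans wle).
rewrite le_eqVlt; apply/orP; left; apply/eqP.
under eq_bigr do rewrite mulr_suml.
rewrite exchange_big/=; apply: eq_bigr => i _; apply: eq_bigr => j _; ring.
Qed.

(** Rescaling both vectors to squared norm n gives 857 q |x| |y|, and the product of norms is at
    most half the sum of squares. *)
Lemma pruned_form_bound (x y : 'I_n -> R) :
  \sum_(e | good_pair e) x e.1 * y e.2 * ((f e)%:R - p)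
    <= 857 * q / 2 * (\sum_i x i ^+ 2 + \sum_i y i ^+ 2).
Proof.
have sq0 (u : 'I_n -> R) : 0 <= \sum_i u i ^+ 2 by apply: sumr_ge0 => i _; apply: sqr_ge0.
have rhs0 : 0 <= 857 * q / 2 * (\sum_i x i ^+ 2 + \sum_i y i ^+ 2).
  by rewrite mulr_ge0 ?addr_ge0// divr_ge0// mulr_ge0// ltW.
have zeroP (u : 'I_n -> R) : \sum_i u i ^+ 2 = 0 -> forall i, u i = 0.
  move=> /eqP; rewrite psumr_eq0 => [/allP u0 i|i _]; last exact: sqr_ge0.
  by have := u0 i (mem_index_enum _); rewrite sqrf_eq0 => /eqP.
have [x0|x0] := eqVneq (\sum_i x i ^+ 2) 0.
  by rewrite big1// => e _; rewrite (zeroP _ x0) !mul0r.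
have [y0|y0] := eqVneq (\sum_i y i ^+ 2) 0.
  by rewrite big1// => e _; rewrite (zeroP _ y0) mulr0 mul0r.
pose al := Num.sqrt (\sum_i x i ^+ 2); pose be := Num.sqrt (\sum_i y i ^+ 2).
pose nu : R := Num.sqrt n%:R.
have al0 : 0 < al by rewrite sqrtr_gt0 lt_def x0 sq0.
have be0 : 0 < be by rewrite sqrtr_gt0 lt_def y0 sq0.
have nu0 : 0 < nu by rewrite sqrtr_gt0 ltr0n.
have alE : \sum_i x i ^+ 2 = al ^+ 2 by rewrite sqr_sqrtr.
have beE : \sum_i y i ^+ 2 = be ^+ 2 by rewrite sqr_sqrtr.
have nuE : n%:R = nu ^+ 2 by rewrite sqr_sqrtr.
have scaled (u : 'I_n -> R) a : 0 < a -> \sum_i u i ^+ 2 = a ^+ 2 ->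
    \sum_i (nu / a * u i) ^+ 2 <= n%:R.
  move=> a0 uE; under eq_bigr do rewrite exprMn.
  rewrite -mulr_sumr uE -exprMn divfK ?gt_eqF// nuE lexx//.
have := pruned_form_unit (scaled _ _ al0 alE) (scaled _ _ be0 beE).
have -> : \sum_(e | good_pair e) nu / al * x e.1 * (nu / be * y e.2) * ((f e)%:R - p) =
    nu ^+ 2 / (al * be) * \sum_(e | good_pair e) x e.1 * y e.2 * ((f e)%:R - p).
  rewrite mulr_sumr; apply: eq_bigr => e _.
  by field; rewrite (gt_eqF al0) (gt_eqF be0).
rewrite alE beE nuE; move: (\sum_(e | _) _) => F.
have -> : nu ^+ 2 / (al * be) * F = (F / (al * be)) * nu ^+ 2 by ring.
rewrite ler_pM2r ?exprn_gt0// ler_pdivrMr ?mulr_gt0// => /le_trans; apply.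
have : 0 <= q * (al - be) ^+ 2 by rewrite mulr_ge0 ?sqr_ge0 ?ltW.
lra.
Qed.

End PrunedForm.

(** * Bilinear forms, the spectral norm and Hadamard products *)

Section FormBound.
Variables (R : realType) (n : nat).
Implicit Types (A M W : 'M[R]_n) (x y v : 'I_n -> R).

(** For c >= 0 this amounts to x^T M y <= c |x| |y|, by rescaling x against y; the additive right
    side has no square roots and can be summed over families of vectors. *)
Definition form_bound M (c : R) := forall x y,
  \sum_i \sum_j x i * M i j * y j <= c / 2 * (\sum_i x i ^+ 2 + \sum_i y i ^+ 2).

(** With N = |Mx|^2, testing the form at Mx / c and x gives N / c <= N / (2c) + c / 2, that is N <=
    c^2. *)
Lemma spectral_norm_le M c : 0 < c -> form_bound M c -> spectral_norm M <= c.
Proof.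
move=> c0 Mc; apply: ge_sup.
  exists (l2norm (M *m 0)); exists 0 => //=; rewrite /l2norm.
  by rewrite big1 ?sqrtr0// => i _; rewrite mxE expr0n.
move=> _ [x /= x1 <-]; rewrite /l2norm.
have X1 : \sum_i x i 0 ^+ 2 <= 1.
  rewrite -(@ler_psqrt _ _ 1) ?nnegrE// ?sqrtr1//.
  by apply: sumr_ge0 => i _; apply: sqr_ge0.
rewrite -[leRHS]gtr0_norm// -sqrtr_sqr ler_wsqrtr//.
set N := \sum_i _.
have := Mc (fun i => c^-1 * (M *m x) i 0) (fun j => x j 0).
have -> : \sum_i \sum_j c^-1 * (M *m x) i 0 * M i j * x j 0 = c^-1 * N.
  rewrite mulr_sumr; apply: eq_bigr => i _.
  rewrite expr2 mulrA [X in _ = _ * X]mxE mulr_sumr.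
  by apply: eq_bigr => j _; rewrite mulrA.
have -> : \sum_i (c^-1 * (M *m x) i 0) ^+ 2 = (c ^+ 2)^-1 * N.
  by rewrite mulr_sumr; apply: eq_bigr => i _; rewrite exprMn exprVn.
move=> h.
have : c^-1 * N <= c / 2 * ((c ^+ 2)^-1 * N + 1).
  by apply: (le_trans h); apply: ler_wpM2l; [rewrite divr_ge0 ?ltW|rewrite lerD2l].
have -> : c / 2 * ((c ^+ 2)^-1 * N + 1) = c^-1 * N / 2 + c / 2 by field; rewrite gt_eqF.
move=> h2; have : c^-1 * N <= c by lra.
by rewrite mulrC ler_pdivrMr// expr2.
Qed.

Let quad A x := \sum_i \sum_j x i * A i j * x j.

Lemma quad_shift A i t x : A^T = A ->
  quad A (fun j => x j + t * (j == i)%:R) =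
  quad A x + 2 * t * (\sum_j A i j * x j) + t ^+ 2 * A i i.
Proof.
move=> AT; have As j k : A j k = A k j by rewrite -{1}AT mxE.
have delta (F : 'I_n -> R) : \sum_j (j == i)%:R * F j = F i.
  rewrite (bigD1 i)//= eqxx mul1r big1 ?addr0// => j /negbTE ->.
  by rewrite mul0r.
have row j : \sum_k (x j + t * (j == i)%:R) * A j k * (x k + t * (k == i)%:R) =
    (\sum_k x j * A j k * x k) + (j == i)%:R * (t * (\sum_k A j k * x k)) +
    t * (A i j * x j) + (j == i)%:R * (t ^+ 2 * A j i).
  have -> : t * (A i j * x j) = \sum_k (k == i)%:R * (t * (A k j * x j)).
    by rewrite (delta (fun k => t * (A k j * x j))).
  have -> : (j == i)%:R * (t ^+ 2 * A j i) =
      \sum_k (k == i)%:R * ((j == i)%:R * (t ^+ 2 * A j k)).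
    by rewrite (delta (fun k => (j == i)%:R * (t ^+ 2 * A j k))).
  rewrite !mulr_sumr -!big_split/=; apply: eq_bigr => k _.
  by rewrite (As k j); ring.
rewrite /quad (eq_bigr _ (fun j _ => row j)) !big_split/=.
rewrite (delta (fun j => t * (\sum_k A j k * x k))) (delta (fun j => t ^+ 2 * A j i)).
by rewrite -mulr_sumr; ring.
Qed.

Lemma psd_quad A : psd A -> forall x, 0 <= quad A x.
Proof.
case=> _ Aq x; have := Aq (\col_i x i); rewrite mxE.
rewrite (_ : \sum_j _ = quad A x)// /quad exchange_big/=.
by apply: eq_bigr => j _; rewrite !mxE mulr_suml; apply: eq_bigr => i _; rewrite !mxE.
Qed.

Lemma psd_diag_ge0 A i : psd A -> 0 <= A i i.
Proof.
move=> Apsd; have AT := Apsd.1.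
have := psd_quad Apsd (fun j => 0 + 1 * (j == i)%:R).
rewrite (@quad_shift A i 1 (fun=> 0))//.
have -> : quad A (fun=> 0) = 0.
  by rewrite /quad big1 // => j _; rewrite big1 // => k _; rewrite mulr0.
have -> : \sum_j A i j * 0 = 0 by rewrite big1 // => k _; rewrite mulr0.
by rewrite mulr0 !add0r expr1n mul1r.
Qed.

(** At e_j + t e_i the form is affine in t with slope 2 A_ij, so it stays nonnegative for all t only
    if the slope is 0. *)
Lemma psd_diag0 A i j : psd A -> A i i = 0 -> A i j = 0.
Proof.
move=> Apsd Ai0; have AT := Apsd.1.
pose e k : R := (k == j)%:R.
have shift t : 0 <= quad A e + 2 * t * A i j.
  have := psd_quad Apsd (fun k => e k + t * (k == i)%:R).
  rewrite quad_shift// Ai0 mulr0 addr0.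
  rewrite (bigD1 j)//= /e eqxx mulr1 big1 ?addr0// => k /negbTE ->.
  by rewrite mulr0.
apply/eqP; apply: contraT => Aij0.
have := shift (- (quad A e + 1) / (2 * A i j)).
have -> : 2 * (- (quad A e + 1) / (2 * A i j)) * A i j = - (quad A e + 1).
  by field.
lra.
Qed.

(** Induction on the number of nonzero diagonal entries; when none is left, [psd_diag0] makes the
    matrix zero. *)
Lemma psd_gram A : psd A ->
  exists s : seq ('I_n -> R), forall i j, A i j = \sum_(v <- s) v i * v j.
Proof.
have [m] := ubnP #|[set i | A i i != 0]|; elim: m A => // m IH A Am Apsd.
have [AT _] := Apsd; have As j k : A j k = A k j by rewrite -{1}AT mxE.
(* Cholesky step: subtracting the rank-one matrix built from row i kills the diagonal
   entry i and no other diagonal zero. *)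
have [i Ai|A0] := pickP (fun i => A i i != 0); last first.
  exists [::] => i j; rewrite big_nil; apply: psd_diag0 => //.
  by have /negbFE/eqP := A0 i.
have a0 : 0 < A i i by rewrite lt_def Ai psd_diag_ge0.
pose r := Num.sqrt (A i i).
have r2 : A i i = r ^+ 2 by rewrite sqr_sqrtr// ltW.
have r0 : 0 < r by rewrite sqrtr_gt0.
pose A' : 'M[R]_n := \matrix_(j, k) (A j k - A i j / r * (A i k / r)).
have A'psd : psd A'.
  split=> [|x]; first by apply/matrixP => j k; rewrite !mxE As mulrC.
  have -> : (x^T *m A' *m x) 0 0 = quad A' (fun j => x j 0).
    rewrite mxE /quad exchange_big/=.
    by apply: eq_bigr => j _; rewrite mxE mulr_suml; apply: eq_bigr => k _; rewrite !mxE.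
  (* Completing the square: the form of A' at x is that of A at x - (l / A_ii) e_i, hence
     nonnegative. *)
  have := psd_quad Apsd (fun j => x j 0 + - (\sum_j A i j * x j 0) / A i i * (j == i)%:R).
  rewrite quad_shift//; set l := \sum_j _.
  suff -> : quad A' (fun j => x j 0) = quad A (fun j => x j 0) +
      2 * (- l / A i i) * l + (- l / A i i) ^+ 2 * A i i by [].
  have -> : quad A' (fun j => x j 0) = quad A (fun j => x j 0) - (l / r) ^+ 2.
    rewrite /quad expr2 /l !mulr_suml -sumrB; apply: eq_bigr => j _.
    rewrite mulr_sumr -sumrB; apply: eq_bigr => k _; rewrite mxE; ring.
  by rewrite r2; field; rewrite gt_eqF.
have A'i : A' i i = 0 by rewrite mxE r2; field; rewrite gt_eqF.
have [|s sP] := IH A' _ A'psd.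
  apply: (@leq_trans #|[set i | A i i != 0]|); last by rewrite -ltnS.
  apply: proper_card; apply/properP; split; last first.
    by exists i; rewrite inE// A'i eqxx.
  apply/subsetP => j; rewrite !inE; apply: contraNneq => Aj.
  by rewrite mxE Aj (As i j) (psd_diag0 _ Apsd Aj) !mul0r subrr.
exists ((fun j => A i j / r) :: s) => j k.
by rewrite big_cons -sP mxE; ring.
Qed.

(** Summed over the Gram vectors v, the squared norms of x o v give the sum of x_i^2 A_ii, and A_ii
    <= 1. *)
Lemma form_bound_hadamard A W c : 0 <= c -> psd A -> bounded_entries A ->
  form_bound W c -> form_bound (hadamard A W) c.
Proof.
move=> c0 Apsd Ab Wc x y; have [s sP] := psd_gram Apsd.
have -> : \sum_i \sum_j x i * hadamard A W i j * y j =
    \sum_(v <- s) \sum_i \sum_j (x i * v i) * W i j * (y j * v j).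
  rewrite [RHS]exchange_big/=; apply: eq_bigr => i _.
  rewrite [RHS]exchange_big/=; apply: eq_bigr => j _.
  rewrite mxE sP mulr_suml mulr_sumr mulr_suml; apply: eq_bigr => v _; ring.
apply: (@le_trans _ _ (\sum_(v <- s) c / 2 *
    (\sum_i (x i * v i) ^+ 2 + \sum_i (y i * v i) ^+ 2))).
  by apply: ler_sum => v _; apply: Wc.
rewrite -mulr_sumr ler_wpM2l ?divr_ge0// big_split/=.
have diag (u : 'I_n -> R) : \sum_(v <- s) \sum_i (u i * v i) ^+ 2 <= \sum_i u i ^+ 2.
  rewrite exchange_big/=; apply: ler_sum => i _.
  have -> : \sum_(v <- s) (u i * v i) ^+ 2 = u i ^+ 2 * A i i.
    by rewrite sP mulr_sumr; apply: eq_bigr => v _; rewrite exprMn expr2.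
  by rewrite ler_piMr ?sqr_ge0// (le_trans (ler_norm _)).
by apply: lerD.
Qed.

End FormBound.

(** * The pruned sample and its normalisation *)

Section PrunedSample.
Variables (R : realType) (n L : nat) (p q : R) (f : {ffun 'I_n * 'I_n -> bool}).
Hypotheses (n0 : (0 < n)%N) (nL : (n.+3 <= L)%N) (p0 : 0 < p) (q1 : 1 <= q).
Hypothesis pnq : p * n%:R = q ^+ 2.
Hypothesis light : forall z w : {ffun 'I_n -> 'I_L * bool},
  lev_vec R z -> lev_vec R w -> light_sum p q f z w <= 68 * q * n%:R.
Hypothesis disc : forall (I J : {set 'I_n}) (j : 'I_L),
  I != set0 -> J != set0 -> (0 < j)%N ->
  (1 + ln (lev R j)) * count_in R f I J <=
  4 * (p * #|I|%:R * #|J|%:R * lev R j) + 4 * ent R n #|I| + 4 * ent R n #|J|.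
Implicit Types x y : 'I_n -> R.

Let q0 : 0 < q. Proof. exact: lt_le_trans q1. Qed.
Let n0R : 0 < n%:R :> R. Proof. by rewrite ltr0n. Qed.
(** 857 comes from the good pairs and 2 from the discarded ones. *)
Let K : R := 859.

Definition pruned_sample := [set e | f e && good_pair q f e].

(** Cauchy-Schwarz, by expanding the square and using x y <= (x^2 + y^2) / 2. *)
Lemma sqr_sum_le (P : {set 'I_n}) x :
  (\sum_(i in P) x i) ^+ 2 <= #|P|%:R * \sum_i x i ^+ 2.
Proof.
apply: (@le_trans _ _ (#|P|%:R * \sum_(i in P) x i ^+ 2)); last first.
  rewrite ler_wpM2l// [leLHS]big_mkcond; apply: ler_sum => i _.
  by case: ifP => // _; apply: sqr_ge0.
have e1 : \sum_(i in P) \sum_(j in P) 2^-1 * x i ^+ 2 =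
    2^-1 * (#|P|%:R * \sum_(i in P) x i ^+ 2).
  rewrite 2!mulr_sumr; apply: eq_bigr => i _.
  by rewrite sumr_const -[LHS]mulr_natl; ring.
have e2 : \sum_(i in P) \sum_(j in P) 2^-1 * x j ^+ 2 =
    2^-1 * (#|P|%:R * \sum_(i in P) x i ^+ 2).
  by rewrite sumr_const -mulr_sumr -[LHS]mulr_natl; ring.
have : (\sum_(i in P) x i) ^+ 2 <=
    \sum_(i in P) \sum_(j in P) (2^-1 * x i ^+ 2 + 2^-1 * x j ^+ 2).
  rewrite expr2 big_distrlr/=; apply: ler_sum => i _; apply: ler_sum => j _.
  by have := sqr_ge0 (x i - x j); lra.
move=> /le_trans; apply.
under eq_bigr do rewrite big_split/=.
by rewrite big_split/= e1 e2; lra.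
Qed.

(** With sums x1, y1 over good and x2, y2 over bad indices, the left side is x2 (y1 + y2) + x1 y2.
    As at most n / q^2 rows and as many columns are bad, q x2 and q y2 obey the same bound as full
    sums, and AM-GM concludes. *)
Lemma good_pair_complement_sum x y :
  \sum_i \sum_j x i * y j - \sum_(e | good_pair q f e) x e.1 * y e.2
    <= n%:R / q * (\sum_i x i ^+ 2 + \sum_i y i ^+ 2).
Proof.
have -> : \sum_(e | good_pair q f e) x e.1 * y e.2 =
    (\sum_(i in good_rows q f) x i) * (\sum_(j in good_cols q f) y j).
  by rewrite big_distrlr/= pair_big.
have -> : \sum_i \sum_j x i * y j = (\sum_i x i) * (\sum_j y j) by rewrite big_distrlr.
have split_sum (P : {set 'I_n}) (u : 'I_n -> R) :
    \sum_i u i = \sum_(i in P) u i + \sum_(i in ~: P) u i.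
  rewrite (bigID (fun i => i \in P))/=; congr (_ + _).
  by apply: eq_bigl => i; rewrite inE.
have Ex := split_sum (good_rows q f) x; have Ey := split_sum (good_cols q f) y.
have tot (u : 'I_n -> R) (P : {set 'I_n}) :
    (\sum_(i in P) u i) ^+ 2 <= n%:R * \sum_i u i ^+ 2.
  apply: le_trans (sqr_sum_le _ _) _; rewrite ler_wpM2r//.
    by apply: sumr_ge0 => i _; apply: sqr_ge0.
  by rewrite ler_nat -[X in (_ <= X)%N](card_ord n) max_card.
have bad (u : 'I_n -> R) (P : {set 'I_n}) : q ^+ 2 * #|P|%:R <= n%:R ->
    q ^+ 2 * (\sum_(i in P) u i) ^+ 2 <= n%:R * \sum_i u i ^+ 2.
  move=> Pn; apply: (@le_trans _ _ (q ^+ 2 * (#|P|%:R * \sum_i u i ^+ 2))).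
    by rewrite ler_wpM2l ?sqr_ge0// sqr_sum_le.
  rewrite mulrA ler_wpM2r//.
  by apply: sumr_ge0 => i _; apply: sqr_ge0.
have bx := bad x _ (bad_rows_bound n0 nL (ltW p0) q1 pnq disc).
have by_ := bad y _ (bad_cols_bound n0 nL (ltW p0) q1 pnq disc).
have gx := tot x (good_rows q f).
have ty : (\sum_j y j) ^+ 2 <= n%:R * \sum_i y i ^+ 2.
  by have := tot y setT; rewrite (eq_bigl predT) // => i; rewrite inE.
move: bx by_ gx ty; rewrite Ex.
move: (\sum_(i in good_rows q f) x i) (\sum_(i in ~: good_rows q f) x i) => x1 x2.
rewrite Ey mulrDl.
move: (\sum_(i in good_cols q f) y i) (\sum_(i in ~: good_cols q f) y i) => y1 y2.
move: (\sum_i x i ^+ 2) (\sum_i y i ^+ 2) => X Y bx by_ gx ty.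
have -> : n%:R / q * (X + Y) = (n%:R * X + n%:R * Y) / q by ring.
rewrite ler_pdivlMr//.
have := sqr_ge0 (q * x2 - (y1 + y2)); have := sqr_ge0 (q * y2 - x1).
nra.
Qed.

(** pJ - S' is minus the centred sample on good pairs plus pJ on discarded ones; the latter costs q
    times the sum of squares because p n = q^2. Replacing x by -x gives the absolute value. *)
Lemma pruned_sample_form x y :
  `|p * (\sum_i \sum_j x i * y j) - \sum_(e in pruned_sample) x e.1 * y e.2|
    <= K * q / 2 * (\sum_i x i ^+ 2 + \sum_i y i ^+ 2).
Proof.
have one_sided u : \sum_i u i ^+ 2 = \sum_i x i ^+ 2 ->
    p * (\sum_i \sum_j u i * y j) - \sum_(e in pruned_sample) u e.1 * y e.2
    <= K * q / 2 * (\sum_i x i ^+ 2 + \sum_i y i ^+ 2).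
  move=> ux.
  have := pruned_form_bound n0 nL (ltW p0) q1 pnq light disc (fun i => - u i) y.
  have -> : \sum_i (- u i) ^+ 2 = \sum_i x i ^+ 2.
    by rewrite -ux; apply: eq_bigr => i _; rewrite sqrrN.
  have -> : \sum_(e | good_pair q f e) - u e.1 * y e.2 * ((f e)%:R - p) =
      p * (\sum_(e | good_pair q f e) u e.1 * y e.2) -
      \sum_(e in pruned_sample) u e.1 * y e.2.
    rewrite mulr_sumr; under [X in _ = _ - X]eq_bigl do rewrite inE andbC.
    rewrite [X in _ = _ - X]big_mkcondr/= -sumrB; apply: eq_bigr => e _.
    by case: (f e) => /=; ring.
  have := good_pair_complement_sum u y; rewrite ux.
  move: (\sum_i x i ^+ 2 + _) => X.
  move=> /(ler_wpM2l (ltW p0)).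
  have -> : p * (n%:R / q * X) = q * X.
    have -> : p * (n%:R / q * X) = (p * n%:R) / q * X by ring.
    by rewrite pnq; field; rewrite gt_eqF.
  rewrite /K; lra.
have h1 := one_sided x erefl.
have h2 := one_sided (fun i => - x i) (eq_bigr _ (fun i _ => sqrrN _)).
rewrite ler_norml h1 andbT lerNl; apply: le_trans h2.
rewrite opprB -(opprK (\sum_(e in _) x _ * _)) addrC -sumrN -mulrN -sumrN.
rewrite le_eqVlt; apply/orP; left; apply/eqP; congr (_ * _ - _).
  by apply: eq_bigr => i _; rewrite -sumrN; apply: eq_bigr => j _; rewrite mulNr.
by apply: eq_bigr => e _; rewrite mulNr.
Qed.

Lemma pruned_sample_card : `|p * n%:R ^+ 2 - #|pruned_sample|%:R| <= K * q * n%:R.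
Proof.
have := pruned_sample_form (fun=> 1) (fun=> 1).
under eq_bigr do under eq_bigr do rewrite mulr1.
under [X in _ - X]eq_bigr do rewrite mulr1.
have -> : \sum_(i < n) (1 : R) ^+ 2 = n%:R.
  by under eq_bigr do rewrite expr1n; rewrite sumr_const card_ord.
have -> : \sum_(i < n) \sum_(j < n) (1 : R) = n%:R ^+ 2.
  rewrite sumr_const card_ord sumr_const card_ord -[LHS]mulr_natl expr2//.
rewrite sumr_const => /le_trans; apply; lra.
Qed.

(** As q >= 4K, the size s differs from p n^2 = q^2 n by at most a quarter of it, so n^2 / s can
    replace 1 / p. *)
Lemma pruned_sample_form_bound : 4 * K <= q ->
  form_bound (const_mx 1 - sampling_mx R pruned_sample) (4 * K * n%:R / q).
Proof.
move=> Kq x y.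
have card := pruned_sample_card.
have frm := pruned_sample_form x y.
set s : R := #|pruned_sample|%:R in card *.
set Sxy := \sum_i \sum_j x i * y j in frm *.
set F := \sum_(e in pruned_sample) _ in frm *.
set Z := \sum_i x i ^+ 2 + \sum_i y i ^+ 2 in frm *.
have sumE : \sum_i \sum_j x i * (const_mx 1 - sampling_mx R pruned_sample) i j * y j =
    Sxy - n%:R ^+ 2 / s * F.
  rewrite /Sxy /F !pair_bigA/= mulr_sumr [X in _ = _ - X]big_mkcond -sumrB.
  apply: eq_bigr => -[i j] _ /=; rewrite !mxE.
  by case: ifP => _; rewrite -/s; ring.
have SxyZ : `|Sxy| <= n%:R / 2 * Z.
  have -> : Sxy = (\sum_i x i) * (\sum_j y j) by rewrite big_distrlr.
  have tot (u : 'I_n -> R) : (\sum_i u i) ^+ 2 <= n%:R * \sum_i u i ^+ 2.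
    have := sqr_sum_le setT u; rewrite cardsT card_ord.
    by rewrite (eq_bigl predT) // => i; rewrite inE.
  have := tot x; have := tot y; rewrite /Z.
  move: (\sum_i x i) (\sum_j y j) => a b ha hb.
  have := sqr_ge0 (a - b); have := sqr_ge0 (a + b).
  move=> h1 h2; rewrite ler_norml; apply/andP; split; lra.
have Z0 : 0 <= Z by apply: addr_ge0; apply: sumr_ge0 => i _; apply: sqr_ge0.
rewrite sumE.
have nE : n%:R = q ^+ 2 / p by rewrite -pnq mulrC mulKf ?gt_eqF.
have K0 : 0 < K by [].
have pn : p * n%:R ^+ 2 = q ^+ 2 * n%:R by rewrite -pnq; ring.
have card' : `|q ^+ 2 * n%:R - s| <= K * q * n%:R by rewrite -pn.
have qn : 4 * (K * q * n%:R) <= q ^+ 2 * n%:R.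
  by rewrite !mulrA ler_pM2r// expr2 ler_pM2r.
have Kqn0 : 0 < K * q * n%:R by rewrite !mulr_gt0.
move: card'; rewrite ler_norml => /andP[c1 c2].
have s0 : 0 < s by lra.
have s34 : 3 / 4 * (q ^+ 2 * n%:R) <= s by lra.
(* Multiplied by s, the form is n^2 (p Sxy - F) + (s - p n^2) Sxy, and each summand is at most K q
   n^2 Z / 2. *)
have -> : Sxy - n%:R ^+ 2 / s * F =
    (n%:R ^+ 2 * (p * Sxy - F) + (s - q ^+ 2 * n%:R) * Sxy) / s - n%:R ^+ 2 * p * Sxy / s +
      q ^+ 2 * n%:R * Sxy / s by field; rewrite gt_eqF.
have -> : n%:R ^+ 2 * p = q ^+ 2 * n%:R by rewrite mulrC.
rewrite subrK ler_pdivrMr//.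
apply: (@le_trans _ _ (n%:R ^+ 2 * (K * q / 2 * Z) + K * q * n%:R * (n%:R / 2 * Z))).
  apply: lerD; first by rewrite ler_wpM2l ?sqr_ge0// (le_trans (ler_norm _)).
  apply: le_trans (ler_norm _) _; rewrite normrM; apply: ler_pM => //.
  by rewrite distrC ler_norml c1.
have -> : n%:R ^+ 2 * (K * q / 2 * Z) + K * q * n%:R * (n%:R / 2 * Z) =
  n%:R ^+ 2 * K * q * Z by field.
have -> : 4 * K * n%:R / q / 2 * Z * s = 2 * K * n%:R * Z / q * s by field; rewrite gt_eqF.
apply: (@le_trans _ _ (2 * K * n%:R * Z / q * (3 / 4 * (q ^+ 2 * n%:R)))).
  have -> : 2 * K * n%:R * Z / q * (3 / 4 * (q ^+ 2 * n%:R)) =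
    3 / 2 * (n%:R ^+ 2 * K * q * Z) by field; rewrite gt_eqF.
  have : 0 <= n%:R ^+ 2 * K * q * Z by rewrite !mulr_ge0 // ltW.
  lra.
by rewrite ler_wpM2l// divr_ge0 ?(ltW q0)// !mulr_ge0 ?(ltW K0).
Qed.

End PrunedSample.

(** * Choice of parameters and conclusion *)

Section Sparsifier.
Variable R : realType.

Lemma full_sampling n : (0 < n)%N -> const_mx 1 - sampling_mx R [set: 'I_n * 'I_n] = 0.
Proof.
move=> n0; apply/matrixP => i j; rewrite !mxE inE cardsT card_prod card_ord.
by rewrite natrM -expr2 divff ?subrr// expf_neq0// pnatr_eq0 -lt0n.
Qed.

(** The choice of q makes 4 * 859 n / q equal to eps n. If q^2 > n, then q^2 / n is no probability,
    but n^2 <= q^2 n, so all entries can be kept, with zero error. *)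
Lemma universal_sparsifier n (eps : R) : (0 < n)%N -> 0 < eps -> eps < 1 ->
  exists S : {set 'I_n * 'I_n},
    #|S|%:R <= 20 * 859 ^+ 2 * (n%:R / eps ^+ 2) /\
    form_bound (const_mx 1 - sampling_mx R S) (eps * n%:R).
Proof.
move=> n0; have n7 : (n.+3 <= 7 * n)%N by lia.
move=> e0 e1; pose q : R := 4 * 859 / eps.
have n0R : 0 < n%:R :> R by rewrite ltr0n.
have qK : 4 * 859 <= q by rewrite ler_pdivlMr//; lra.
have q1 : 1 <= q by lra.
have q0 : 0 < q by apply: lt_le_trans q1.
have q2 : 16 * 859 ^+ 2 / eps ^+ 2 = q ^+ 2 by rewrite /q; field; rewrite gt_eqF.
have Cq : 20 * 859 ^+ 2 * (n%:R / eps ^+ 2) = 5 / 4 * (q ^+ 2 * n%:R).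
  by rewrite -q2; field; rewrite gt_eqF.
have qe : 4 * 859 * n%:R / q = eps * n%:R by rewrite /q; field; rewrite gt_eqF.
have [qn|qn] := leP (q ^+ 2) n%:R; last first.
  exists setT; rewrite full_sampling//; split.
    rewrite cardsT card_prod card_ord natrM Cq.
    have := ltW qn; rewrite -(ler_pM2r n0R) => qnn.
    have : 0 <= q ^+ 2 * n%:R by rewrite mulr_ge0 ?sqr_ge0.
    lra.
  move=> x y; rewrite big1 => [|i _].
    rewrite mulr_ge0 ?divr_ge0 ?mulr_ge0 ?(ltW e0)// addr_ge0// sumr_ge0// => i _;
      exact: sqr_ge0.
  by rewrite big1// => j _; rewrite mxE mulr0 mul0r.
pose p := q ^+ 2 / n%:R.
have p0 : 0 < p by rewrite divr_gt0 ?exprn_gt0.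
have p1 : p <= 1 by rewrite ler_pdivrMr// mul1r.
have pnq : p * n%:R = q ^+ 2 by rewrite divfK// gt_eqF.
have nL : (n.+3 <= n.+3)%N by [].
have [f [light disc]] := good_sample_exists n0 (ltW p0) p1 q1 pnq n7.
exists (pruned_sample q f); split; last first.
  by rewrite -qe; apply: (pruned_sample_form_bound n0 nL p0 q1 pnq light disc).
(* The size is at most q^2 n + 859 q n <= (5/4) q^2 n, and q^2 = 16 * 859^2 / eps^2 yields the
   factor 20. *)
have := pruned_sample_card n0 nL p0 q1 pnq light disc.
rewrite Cq ler_norml => /andP[cardS _]; move: cardS.
have -> : p * n%:R ^+ 2 = q ^+ 2 * n%:R by rewrite -pnq; ring.
have := ler_wpM2r (mulr_ge0 (ltW q0) (ltW n0R)) qK.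
lra.
Qed.

End Sparsifier.

Theorem theorem1 (R : realType) :
  exists C : R, 0 < C /\
    forall (n : nat) (eps : R), (0 < n)%N -> 0 < eps -> eps < 1 ->
      exists S : {set 'I_n * 'I_n},
        #|S|%:R <= C * (n%:R / eps ^+ 2) /\
        forall A : 'M[R]_n, psd A -> bounded_entries A ->
          spectral_norm (A - hadamard A (sampling_mx R S)) <= eps * n%:R.
Proof.
exists (20 * 859 ^+ 2); split; first by rewrite mulr_gt0 ?exprn_gt0.
move=> n eps n0 e0 e1; have [S [cardS formS]] := universal_sparsifier n0 e0 e1.
exists S; split=> // A Apsd Ab.
have en0 : 0 < eps * n%:R by rewrite mulr_gt0 ?ltr0n.
apply: spectral_norm_le => //.
(* Factoring out A leaves a single matrix independent of A, so one S serves every A. *)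
have -> : A - hadamard A (sampling_mx R S) =
    hadamard A (const_mx 1 - sampling_mx R S).
  by apply/matrixP => i j; rewrite !mxE mulrBr mulr1.
by apply: form_bound_hadamard => //; apply: ltW.
Qed.
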